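(* Let $k\ge1$, let $\eta$ be an indecomposable endomorphism of a $k$-dimensional vector space $U$ over $\mathbf k$ having an eigenvalue $\lambda\in\mathbf k$, and let $\mathcal S_\eta$ be the associated (indecomposable) sextuple of dimension $3k$. Fix a Jordan basis for $\mathcal S_\eta$. Let $M\in\mathbf k^{k\times k}$ have entries $m_{ij}=(-1)^{j+1}$ if $i=k-j+1$ and $m_{ij}=0$ otherwise. For $K\in\mathbf k^{k\times k}$ write $$H_K=\begin{pmatrix}0&0&-K\\0&K&0\\-K&0&0\end{pmatrix}.$$ 1. $\mathcal S_\eta$ is isomorphic to its dual if and only if $\lambda=\frac12$. Now assume $\lambda=\frac12$. Then: 2. $H_M$ is the coordinate matrix (with respect to the fixed Jordan basis) of a compatible form $B$, which is symplectic if $k$ is even and symmetric if $k$ is odd. 3. Up to isomorphism and multiplication by a scalar, $B$ is the only compatible (symmetric or symplectic) form. For even $k$ there is no symmetric compatible form; for odd $k$ there is no symplectic one. 4. For any $0\neq c\in\mathbf k$, $cB$ and $B$ are isometric via an automorphism of the sextuple if and only if $c$ is a square in $\mathbf k$. 5. A complete list of the compatible symplectic (for $k$ even) resp. symmetric (for $k$ odd) forms is given by the matrices $H_{MQ}$, where $Q=\sum_{i=0}^{k-1}a_iN^i\in\mathbf k^{k\times k}$ with $a_i\in\mathbf k$, $a_0\neq0$ and $a_i=0$ for $i$ odd.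
   Context: Standing assumptions: $\mathbf k$ is a perfect field with $\operatorname{char}\mathbf k\neq 2$; all vector spaces are finite-dimensional over $\mathbf k$. A sextuple $(V;C_i,I_i)$ in $V$ consists of subspaces $I_i\subseteq C_i\subseteq V$, $i=1,2,3$. Isomorphisms are linear bijections $f:V\to V'$ with $f(I_i)=I_i'$, $f(C_i)=C_i'$. The dual of $(V;C_i,I_i)$ is the sextuple in $V^*$ with $C_i$-members $I_i^\circ$ and $I_i$-members $C_i^\circ$ ($^\circ$ = annihilator). A compatible form is a non-degenerate bilinear form on $V$, symmetric or antisymmetric (= symplectic), such that $C_i=I_i^\perp$ for $i=1,2,3$. ''Up to isomorphism'' for forms means up to automorphisms $f$ of the sextuple (acting by $B\mapsto B(f\cdot,f\cdot)$). An endomorphism $(U,\eta)$ is indecomposable if $U\neq0$ and $U$ is not a direct sum of two nonzero $\eta$-invariant subspaces. For $(U,\eta)$, the sextuple $\mathcal S_\eta$ is, in $V=U\times U\times U$: $I_1=U\times0\times0$, $I_2=0\times0\times U$, $I_3=\{(-\eta x,x,-x)\mid x\in U\}$, $C_1=U\times U\times0$, $C_2=0\times U\times U$, $C_3=\{(x,-x,0)\mid x\in U\}+I_3$. A frame basis of $\mathcal S_\eta$ is a basis $(u_1,\dots,u_k,v_1,\dots,v_k,w_1,\dots,w_k)$ of $V$ with $u_i=(x_i,0,0)$, $v_i=(0,x_i,0)$, $w_i=(0,0,x_i)$ for a basis $(x_1,\dots,x_k)$ of $U$. It is a Jordan basis for $\mathcal S_\eta$ if $(x_i)$ is a Jordan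 basis for $\eta$: $\eta(x_1)=\lambda x_1$ and $\eta(x_j)=x_{j-1}+\lambda x_j$ for $j>1$. $N\in\mathbf k^{k\times k}$ is the nilpotent matrix with entries $1$ on the first upper off-diagonal and $0$ elsewhere. *)

(* Defs.v *)
From HB Require Import structures.
From mathcomp Require Import all_boot all_order all_algebra all_field.

Set Implicit Arguments.
Unset Strict Implicit.
Unset Printing Implicit Defensive.

Import GRing.Theory.
Local Open Scope ring_scope.

Definition perfect_field (K : fieldType) : Prop :=
  forall p : {poly K}, irreducible_poly p -> separable_poly p.

Section Sextuples.
Variable K : fieldType.

Record sextuple (V : vectType K) := Sextuple {
  sxC : 'I_3 -> {vspace V};
  sxI : 'I_3 -> {vspace V};
  sxIC : forall i, (sxI i <= sxC i)%VS
}.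

Definition sextuple_iso (V V' : vectType K) (S : sextuple V) (S' : sextuple V')
    (f : 'Hom(V, V')) : Prop :=
  [/\ bijective f,
      forall i, (f @: sxI S i)%VS = sxI S' i
    & forall i, (f @: sxC S i)%VS = sxC S' i].

Definition isomorphic (V V' : vectType K) (S : sextuple V) (S' : sextuple V')
    : Prop :=
  exists f : 'Hom(V, V'), sextuple_iso S S' f.

Section Dual.
Variable V : vectType K.

Definition dual_space : vectType K := 'Hom(V, K^o).

(* A functional vanishes on W iff its composite with a projection onto W is 0;
   the choice of complement made by projv is immaterial, see annihilatorP. *)
Definition restrict_to (W : {vspace V}) (f : dual_space) : dual_space :=
  (f \o projv W)%VF.

Fact restrict_to_is_linear W : linear (restrict_to W).
Proof. by move=> a f g; rewrite /restrict_to comp_lfunDl comp_lfunZl. Qed.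

HB.instance Definition _ W :=
  GRing.isLinear.Build K dual_space dual_space _ (restrict_to W)
    (restrict_to_is_linear W).

Definition annihilator (W : {vspace V}) : {vspace dual_space} :=
  lker (linfun (restrict_to W)).

Lemma annihilatorP (W : {vspace V}) (f : 'Hom(V, K^o)) :
  reflect {in W, forall v, f v = 0} (f \in annihilator W).
Proof.
rewrite memv_ker lfunE /= /restrict_to; apply: (iffP eqP) => [f0 v Wv | f0].
  by rewrite -(projv_id Wv) -comp_lfunE f0 lfunE.
by apply/lfunP=> v; rewrite comp_lfunE lfunE /= f0 ?memv_proj.
Qed.

Lemma annihilatorS (W W' : {vspace V}) :
  (W <= W')%VS -> (annihilator W' <= annihilator W)%VS.
Proof.
move=> /subvP sWW'; apply/subvP=> f /annihilatorP f0.
by apply/annihilatorP=> v /sWW' /f0.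
Qed.

Definition dual_sextuple (S : sextuple V) : sextuple dual_space :=
  @Sextuple dual_space
    (fun i => annihilator (sxI S i)) (fun i => annihilator (sxC S i))
    (fun i => annihilatorS (sxIC S i)).

End Dual.

Section Forms.
Variable V : vectType K.

(* Bilinear forms are taken in {hermitian V for eps & idfun}: eps = false is
   symmetric, eps = true is antisymmetric. *)
Definition compatible_form (S : sextuple V) (eps : bool)
    (B : {hermitian V for eps & idfun}) : Prop :=
  nondegenerate B /\ forall i, sxC S i = orthov B (sxI S i).

Definition isometric_via_aut (S : sextuple V) (B B' : V -> V -> K) : Prop :=
  exists2 f : 'End(V), sextuple_iso S S f & forall u v, B u v = B' (f u) (f v).

Definition coordinate_mx (n : nat) (b : n.-tuple V) (B : V -> V -> K) : 'M[K]_n :=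
  \matrix_(i, j) B (tnth b i) (tnth b j).

End Forms.

Section SextupleOfEndomorphism.
Variable U : vectType K.

Definition indecomposable_end (eta : 'End(U)) : Prop :=
  {:U}%VS != 0%VS /\
  ~ exists W1 W2 : {vspace U},
      [/\ W1 != 0%VS /\ W2 != 0%VS,
          (eta @: W1 <= W1)%VS, (eta @: W2 <= W2)%VS,
          (W1 + W2)%VS = {:U}%VS & (W1 :&: W2)%VS = 0%VS].

Definition cube : vectType K := (U * U * U)%type.

Definition in1 (x : U) : cube := (x, 0, 0).
Definition in2 (x : U) : cube := (0, x, 0).
Definition in3 (x : U) : cube := (0, 0, x).
Definition in12 (x : U) : cube := (x, - x, 0).
Definition graph3 (eta : 'End(U)) (x : U) : cube := (- eta x, x, - x).

Let pairE (T T' : lmodType K) (a : K) (x u : T) (y v : T') :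
  a *: (x, y) + (u, v) = (a *: x + u, a *: y + v).
Proof. by []. Qed.

Fact in1_is_linear : linear in1.
Proof. by move=> a x y; rewrite /in1 !pairE scaler0 addr0. Qed.
Fact in2_is_linear : linear in2.
Proof. by move=> a x y; rewrite /in2 !pairE scaler0 addr0. Qed.
Fact in3_is_linear : linear in3.
Proof. by move=> a x y; rewrite /in3 !pairE scaler0 addr0. Qed.
Fact in12_is_linear : linear in12.
Proof. by move=> a x y; rewrite /in12 !pairE scaler0 addr0 scalerN opprD. Qed.
Fact graph3_is_linear eta : linear (graph3 eta).
Proof. by move=> a x y; rewrite /graph3 !pairE linearP !scalerN !opprD. Qed.

HB.instance Definition _ := GRing.isLinear.Build K U cube _ in1 in1_is_linear.
HB.instance Definition _ := GRing.isLinear.Build K U cube _ in2 in2_is_linear.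
HB.instance Definition _ := GRing.isLinear.Build K U cube _ in3 in3_is_linear.
HB.instance Definition _ := GRing.isLinear.Build K U cube _ in12 in12_is_linear.
HB.instance Definition _ eta :=
  GRing.isLinear.Build K U cube _ (graph3 eta) (graph3_is_linear eta).

Definition Seta_I1 : {vspace cube} := limg (linfun in1).
Definition Seta_I2 : {vspace cube} := limg (linfun in3).
Definition Seta_I3 (eta : 'End(U)) : {vspace cube} := limg (linfun (graph3 eta)).
Definition Seta_C1 : {vspace cube} := (limg (linfun in1) + limg (linfun in2))%VS.
Definition Seta_C2 : {vspace cube} := (limg (linfun in2) + limg (linfun in3))%VS.
Definition Seta_C3 (eta : 'End(U)) : {vspace cube} :=
  (limg (linfun in12) + Seta_I3 eta)%VS.

Lemma Seta_C1P (v : cube) : reflect (v.2 = 0) (v \in Seta_C1).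
Proof.
apply: (iffP memv_addP) => [[_ /memv_imgP[x _ ->] [_ /memv_imgP[y _ ->] ->]]|].
  by rewrite !lfunE /= addr0.
case: v => -[x y] z /= ->.
exists (in1 x); first by rewrite -[in1 x]lfunE memv_img ?memvf.
exists (in2 y); first by rewrite -[in2 y]lfunE memv_img ?memvf.
by rewrite /in1 /in2; congr (_, _, _); rewrite /= ?addr0 ?add0r.
Qed.

Lemma Seta_C2P (v : cube) : reflect (v.1.1 = 0) (v \in Seta_C2).
Proof.
apply: (iffP memv_addP) => [[_ /memv_imgP[x _ ->] [_ /memv_imgP[y _ ->] ->]]|].
  by rewrite !lfunE /= addr0.
case: v => -[x y] z /= ->.
exists (in2 y); first by rewrite -[in2 y]lfunE memv_img ?memvf.
exists (in3 z); first by rewrite -[in3 z]lfunE memv_img ?memvf.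
by rewrite /in2 /in3; congr (_, _, _); rewrite /= ?addr0 ?add0r.
Qed.

Fact Seta_IC eta (i : 'I_3) :
  (tnth [tuple Seta_I1; Seta_I2; Seta_I3 eta] i
     <= tnth [tuple Seta_C1; Seta_C2; Seta_C3 eta] i)%VS.
Proof.
by case: i => [[|[|[|//]]]] lt_i3; rewrite !(tnth_nth 0%VS) /= ?addvSl ?addvSr.
Qed.

Definition Seta (eta : 'End(U)) : sextuple cube :=
  Sextuple (Seta_IC eta).

(* The tuple x is indexed from 0. *)
Definition jordan_basis (k : nat) (eta : 'End(U)) (lambda : K) (x : k.-tuple U)
    : Prop :=
  [/\ basis_of {:U} x,
      eta x`_0 = lambda *: x`_0
    & forall j, (0 < j < k)%N -> eta x`_j = x`_j.-1 + lambda *: x`_j].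

Definition frame (k : nat) (x : k.-tuple U) : (k + (k + k)).-tuple cube :=
  [tuple of map in1 x ++ (map in2 x ++ map in3 x)].

Definition frame_basis (k : nat) (x : k.-tuple U)
    (b : (k + (k + k)).-tuple cube) : Prop :=
  [/\ basis_of {:cube} b, basis_of {:U} x & b = frame x].

Definition jordan_frame_basis (k : nat) (eta : 'End(U)) (lambda : K)
    (b : (k + (k + k)).-tuple cube) : Prop :=
  exists2 x : k.-tuple U, frame_basis x b & jordan_basis eta lambda x.

End SextupleOfEndomorphism.

Section Matrices.
Variable k : nat.

(* Row i : 'I_k is the mathematical row i.+1, likewise for columns. *)
Definition Nmx : 'M[K]_k := \matrix_(i, j) (j == i.+1 :> nat)%:R.

Definition Mmx : 'M[K]_k :=
  \matrix_(i, j) if (i.+1 == k - j.+1 + 1)%N then (-1) ^+ (j.+1 + 1)%N else 0.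

Definition Hmx (A : 'M[K]_k) : 'M[K]_(k + (k + k)) :=
  block_mx 0               (row_mx 0 (- A))
           (col_mx 0 (- A)) (block_mx A 0 0 0).

Definition Qmx (a : nat -> K) : 'M[K]_k := \sum_(i < k) a i *: Nmx ^+ i.

End Matrices.

End Sextuples.

Arguments Nmx {K} k.
Arguments Mmx {K} k.
Arguments Hmx {K k} A.
Arguments Qmx {K} k a.

(* Main.v *)
Require Import Defs.
From HB Require Import structures.
From mathcomp Require Import all_boot all_order all_algebra all_field.
From mathcomp Require Import ring zify.

Set Implicit Arguments.
Unset Strict Implicit.
Unset Printing Implicit Defensive.

Import GRing.Theory.
Local Open Scope ring_scope.

(** The sextuple of eta leaves a bilinear form on U x U x U almost no room.
    Orthogonality of I_1 and C_1, and of I_2 and C_2, kills every block except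
    the three on the antidiagonal; orthogonality of I_3 and C_3 then forces
    these blocks to be -kappa, kappa, -kappa for one form kappa on U, subject
    to kappa (eta x) y + kappa x (eta y) = kappa x y.  So a compatible form is
    the same thing as a non-degenerate kappa, symmetric or antisymmetric, for
    which 1 - eta is adjoint to eta ([orthogonal_glue], [compatible_glue],
    [glue_compatible]).  An isomorphism from the sextuple to its dual is such
    a kappa without the symmetry condition ([dual_iso_glue],
    [glue_dual_iso]), and the automorphisms of the sextuple are the maps
    g x g x g with g commuting with eta ([Seta_automorphism],
    [cube_map_iso]).  Everything is thereby reduced to U.

    Since eta is indecomposable, eta - lambda is nilpotent, and U has a Jordan
    basis ([indecomposable_nilpotent], [indecomposable_jordan_basis]).  If x is
    an eigenvector, then kappa x composed with eta - lambda is
    (1 - 2 lambda) (kappa x); nilpotency forces 1 - 2 lambda = 0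
    ([complement_adjoint_eigenvalue]).

    For lambda = 1/2 and a Jordan basis, the condition on the Gram matrix A of
    kappa reads N^T A = - A N.  The matrix M satisfies it, hence A = M Q with Q
    commuting with N, that is, Q a polynomial in N.  Transposition
    turns N into - M N M^-1, so A has the symmetry type of M if Q is even as a
    polynomial in N, and the opposite type if Q is odd; Q being invertible, it
    has a constant term and must be even ([jordan_gramP]).
    This fixes the symmetry type of the form and gives the list of all Gram
    matrices.

    Finally, g acts on Gram matrices by A |-> P^T A P with P a polynomial in
    N, and P^T M P = M P(-N) P(N).  As 2 is invertible, Q / a_0 has a square
    root P that is a polynomial in Q, hence even in N; this carries a_0 M to
    M Q ([unipotent_sqrt], [jordan_gram_congr]).  Conversely P(-N) P(N) = c
    implies that c is the square of the constant term of P
    ([jordan_gram_scale]). *)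

(** * Indecomposable endomorphisms with an eigenvalue have a Jordan basis *)

Section LfunIter.
Variables (K : fieldType) (U : vectType K).
Implicit Types (nu eta : 'End(U)) (lambda : K).

Definition lfun_iter nu n : 'End(U) := iter n (fun g => (nu \o g)%VF) \1%VF.

Lemma lfun_iterE nu n u : lfun_iter nu n u = iter n nu u.
Proof. by elim: n => [|n IHn] /=; rewrite lfunE //= IHn. Qed.

(** The images of the powers of nu decrease, so their dimensions cannot drop
    for ever. *)
Lemma limg_iter_stable nu :
  exists n, (nu @: limg (lfun_iter nu n))%VS = limg (lfun_iter nu n).
Proof.
pose W n := limg (lfun_iter nu n).
have WS n : W n.+1 = (nu @: W n)%VS by rewrite /W -limg_comp.
have sW n : (W n.+1 <= W n)%VS.
  apply/subvP => _ /memv_imgP[u _ ->].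
  by rewrite lfun_iterE iterSr -lfun_iterE memv_img ?memvf.
suff [n le_n] : exists n, (\dim (W n) <= \dim (W n.+1))%N.
  by exists n; apply/eqP; rewrite eqEdim -/(W n) -WS sW.
suff: forall d n, (\dim (W n) <= d)%N ->
  exists n, (\dim (W n) <= \dim (W n.+1))%N.
  by move=> /(_ (\dim (W 0)) 0%N (leqnn _)).
elim=> [|d IHd] n le_d; first by exists n; rewrite (leq_trans le_d).
case: (leqP (\dim (W n)) (\dim (W n.+1))) => [|lt_n]; first by exists n.
by apply: (IHd n.+1); rewrite -ltnS (leq_trans lt_n).
Qed.

Lemma shift_lfunE eta lambda u :
  eta u = (eta - lambda *: \1%VF) u + lambda *: u.
Proof. by rewrite add_lfunE opp_lfunE scale_lfunE id_lfunE subrK. Qed.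

(** A subspace has to be checked for invariance under eta - lambda only, which
    is the nilpotent map that one wants to work with. *)
Lemma shift_subv eta lambda (W : {vspace U}) :
  ((eta - lambda *: \1%VF) @: W <= W)%VS -> (eta @: W <= W)%VS.
Proof.
move/subvP => sW; apply/subvP => _ /memv_imgP[u Wu ->].
by rewrite (shift_lfunE eta lambda) memvD ?memvZ // sW ?memv_img.
Qed.

(** Fitting's argument: U is the direct sum of the stable image W of
    nu = eta - lambda, on which nu is injective, and of the kernel Z of a power
    of nu.  An eigenvector keeps Z from being 0, so indecomposability leaves
    only W = 0. *)
Lemma indecomposable_nilpotent eta lambda :
  indecomposable_end eta -> passmx.leigenvalue eta lambda ->
  exists n, forall u, iter n (eta - lambda *: \1%VF) u = 0.
Proof.
move=> [_ indec] eig; pose nu := eta - lambda *: \1%VF; rewrite -/nu.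
have [n nuW] := limg_iter_stable nu; exists n => u.
set W := limg _ in nuW; pose Z := lker (lfun_iter nu n).
have dimZW : (\dim Z + \dim W = \dim {:U})%N.
  by rewrite -(limg_ker_dim (lfun_iter nu n) {:U}) capfv.
have Wker : (W :&: lker nu = 0)%VS.
  apply/eqP; rewrite -dimv_eq0 -(eqn_add2r (\dim W)) add0n.
  by rewrite -[in X in (_ + X)%N]nuW limg_ker_dim.
have injW j w : w \in W -> iter j nu w = 0 -> w = 0.
  elim: j w => [|j IHj] w Ww //; rewrite iterSr => nu0.
  have Wnu : nu w \in W by rewrite -nuW memv_img.
  by apply/eqP; rewrite -memv0 -Wker memv_cap Ww memv_ker (IHj _ Wnu nu0) eqxx.
have dxWZ : (W :&: Z = 0)%VS.
  apply/eqP; rewrite -subv0; apply/subvP => w /memv_capP[Ww].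
  by rewrite memv_ker lfun_iterE memv0 => /eqP/(injW _ _ Ww)->.
have defU : (W + Z = fullv)%VS.
  by apply/eqP; rewrite eqEdim subvf dimv_disjoint_sum // addnC dimZW /=.
(* If Z were 0, then W would be everything and nu injective, against the
   existence of an eigenvector. *)
have nzZ : Z != 0%VS.
  apply: contraNneq eig => Z0; rewrite /passmx.leigenspace -/nu.
  by rewrite -Wker -[X in X == _]capfv -defU Z0 addv0.
have W0 : W = 0%VS.
  apply/eqP/negPn/negP => nzW; apply: indec; exists W, Z; split=> //.
    by apply: (@shift_subv _ lambda); rewrite -/nu nuW.
  apply: (@shift_subv _ lambda); apply/subvP => _ /memv_imgP[w Zw ->].
  rewrite memv_ker lfun_iterE -iterSr -lfun_iterE /= lfunE /=.
  by move: Zw; rewrite memv_ker => /eqP->; rewrite linear0.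
by apply/eqP; rewrite -lfun_iterE -memv0 -W0 memv_img ?memvf.
Qed.

Section OrbitCoords.
Variables (phi : {scalar U}) (nu : 'End(U)) (n : nat).

(** The kernel of this map is the largest nu-invariant subspace killed by phi,
    as soon as nu ^ n = 0. *)
Definition orbit_coords u : 'rV[K]_n := \row_i phi (lfun_iter nu i u).

Fact orbit_coords_is_linear : linear orbit_coords.
Proof. by move=> a u v; apply/rowP => i; rewrite !mxE !linearP. Qed.

HB.instance Definition _ :=
  GRing.isLinear.Build K U 'rV[K]_n _ orbit_coords orbit_coords_is_linear.

End OrbitCoords.

Lemma scalar_sep (v : U) : v != 0 -> exists phi : {scalar U}, phi v != 0.
Proof.
move=> nz_v; have [i nz_i | v0] := pickP (fun i => coord (vbasis {:U}) i v != 0).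
  by exists (coord (vbasis {:U}) i).
case/eqP: nz_v; rewrite (coord_vbasis (memvf v)) big1 // => i _.
by move/negbFE/eqP: (v0 i) => ->; rewrite scale0r.
Qed.

(** Let m.+1 be the nilpotency index of nu = eta - lambda, and choose y and a
    linear form phi with phi (nu ^ m y) <> 0.  The span W of the chain
    nu ^ i y and the subspace Z where every phi \o nu ^ i vanishes are both
    invariant.  The matrix of the values phi (nu ^ (i + j) y) is triangular with
    respect to the antidiagonal, with non-zero entries there, so W meets Z
    trivially; Z has codimension at most m.+1.  Hence U is the direct sum of W
    and Z, indecomposability gives Z = 0, and the chain, read backwards, is a
    Jordan basis. *)
Lemma indecomposable_jordan_basis eta lambda (k : nat) : \dim {:U} = k ->
  indecomposable_end eta -> passmx.leigenvalue eta lambda ->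
  exists x : k.-tuple U, jordan_basis eta lambda x.
Proof.
move=> dimU indec eig; have [n0 nil0] := indecomposable_nilpotent indec eig.
have [nzU indecU] := indec.
move: nil0; set nu := eta - lambda *: \1%VF => nil0.
have etaE u : eta u = nu u + lambda *: u by apply: shift_lfunE.
have nuS (W : {vspace U}) : (nu @: W <= W)%VS -> (eta @: W <= W)%VS.
  exact: shift_subv.
clearbody nu.
have [m nil_m nz_m] : exists2 m, lfun_iter nu m.+1 = 0 & lfun_iter nu m != 0.
  have ex_n : exists n, lfun_iter nu n == 0.
    by exists n0; apply/eqP/lfunP => u; rewrite lfun_iterE nil0 lfunE.
  case: (ex_minnP ex_n) => -[|m] /eqP nil_m min_m.
    case/eqP: nzU; apply/vspaceP => u; rewrite memvf memv0.
    by have /lfunP/(_ u) := nil_m; rewrite !lfunE /= => ->; rewrite eqxx.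
  by exists m => //; apply/negP => /min_m; rewrite ltnn.
have iter0 j u : (m < j)%N -> iter j nu u = 0.
  move=> lt_mj; rewrite -(subnK lt_mj) iterD -[iter m.+1 _ _]lfun_iterE nil_m lfunE /=.
  by rewrite -lfun_iterE linear0.
have [y nz_y] : exists y, iter m nu y != 0.
  have: vpick (limg (lfun_iter nu m)) != 0.
    apply: contraNneq nz_m => /eqP; rewrite vpick0 -lkerE => /subvP ker_m.
    apply/eqP/lfunP => u; rewrite zero_lfunE.
    by have := ker_m u (memvf u); rewrite memv_ker => /eqP.
  have /memv_imgP[y _ ->] := memv_pick (limg (lfun_iter nu m)).
  by rewrite lfun_iterE; exists y.
have [phi nz_phi] := scalar_sep nz_y.
pose X := [tuple iter (m - i) nu y | i < m.+1].
have X_nth j : (j <= m)%N -> X`_j = iter (m - j) nu y.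
  move=> le_jm; have lt_jm : (j < m.+1)%N by [].
  by rewrite -[j]/(nat_of_ord (Ordinal lt_jm)) -tnth_nth tnth_mktuple.
pose h := linfun (orbit_coords phi nu m.+1).
have hX0 (a : 'I_m.+1 -> K) : h (\sum_i a i *: X`_i) = 0 -> forall i, a i = 0.
  rewrite lfunE /= => /rowP ha i.
  (* The coefficients vanish one after the other, starting from the last one:
     once a j = 0 for all j > i, applying phi \o nu ^ i leaves only a i. *)
  have [d] := ubnP (m - i)%N; elim: d i => // d IHd i le_d.
  have := ha i; rewrite !mxE lfun_iterE.
  have -> : iter i nu (\sum_j a j *: X`_j) = \sum_j a j *: iter (i + (m - j)) nu y.
    rewrite -lfun_iterE linear_sum; apply: eq_bigr => j _.
    by rewrite linearZ /= lfun_iterE X_nth -?iterD // -ltnS ltn_ord.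
  rewrite linear_sum (bigD1 i) //= big1 => [|j ne_ji].
    rewrite linearZ /= addr0 subnKC -1?ltnS ?ltn_ord // => /eqP.
    by rewrite mulf_eq0 (negPf nz_phi) orbF => /eqP.
  have lt_j := ltn_ord j; have lt_i := ltn_ord i.
  case: (ltngtP i j) => [lt_ij | lt_ji | /val_inj Eij].
  - by rewrite IHd ?scale0r ?linear0 //; lia.
  - by rewrite iter0 ?scaler0 ?linear0 //; lia.
  by rewrite Eij eqxx in ne_ji.
have freeX : free X by apply/freeP => a aX; apply: hX0; rewrite aX linear0.
pose W := <<X>>%VS; pose Z := lker h.
have dxWZ : (W :&: Z = 0)%VS.
  apply/eqP; rewrite -subv0; apply/subvP => w /memv_capP[Ww].
  rewrite memv_ker {1}(coord_span Ww) => /eqP/hX0 w0.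
  by rewrite (coord_span Ww) big1 ?memv0 // => i _; rewrite w0 scale0r.
have dimW : \dim W = m.+1 by rewrite (eqnP freeX) size_tuple.
have defU : (W + Z = fullv)%VS.
  apply/eqP; rewrite eqEdim subvf dimv_disjoint_sum //= dimW.
  rewrite -(limg_ker_dim h {:U}) capfv addnC leq_add2r.
  by rewrite (leq_trans (dimvS (subvf _))) // dimvf eq_leq //; apply: mul1n.
have Z0 : Z = 0%VS.
  apply/eqP/negPn/negP => nzZ; apply: indecU; exists W, Z; split=> //.
  - by split=> //; rewrite -dimv_eq0 dimW.
  - apply: nuS; rewrite limg_span; apply/span_subvP.
    move=> _ /mapP[_ /mapP[i _ ->] ->]; rewrite -iterS.
    case: (posnP i) => [-> | i_gt0]; first by rewrite subn0 iter0 ?mem0v.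
    have lt_i := ltn_ord i.
    have -> : (m - i).+1 = (m - i.-1)%N by lia.
    by rewrite -X_nth ?memv_span ?mem_nth ?size_tuple //; lia.
  apply: nuS; apply/subvP => _ /memv_imgP[u Zu ->].
  move: Zu; rewrite !memv_ker !lfunE /= => /eqP/rowP hu; apply/eqP/rowP => i.
  rewrite !mxE lfun_iterE -iterSr; have := ltn_ord i; rewrite ltnS leq_eqVlt.
  case/predU1P => [-> | lt_im]; first by rewrite iter0 ?linear0.
  have lt_i : (i.+1 < m.+1)%N by [].
  by have := hu (Ordinal lt_i); rewrite !mxE lfun_iterE.
have basX : basis_of {:U} X.
  by rewrite /basis_of freeX andbT -defU Z0 addv0.
move: (size_basis basX); rewrite dimU => Dk; move: dimU; rewrite Dk => dimU.
exists X; split=> //.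
  by rewrite etaE X_nth // subn0 -iterS iter0 ?add0r.
move=> j /andP[j_gt0 lt_j]; rewrite etaE !X_nth //; last by lia.
by rewrite -iterS; have -> : (m - j).+1 = (m - j.-1)%N by lia.
Qed.

End LfunIter.

(** * Bilinear forms adapted to the sextuple of an endomorphism *)

Section SetaMembership.
Variables (K : fieldType) (U : vectType K) (eta : 'End(U)).
Implicit Types (u v : cube U) (i : 'I_3).

(** Equations for the subspaces of the sextuple; the last branch of each match
    is reached by the index 2 only.  In C_3, eliminating the parameters of
    in12 s + graph3 eta t leaves the single equation below. *)
Definition in_I i u : Prop :=
  match val i with
  | 0 => u.1.2 = 0 /\ u.2 = 0
  | 1 => u.1.1 = 0 /\ u.1.2 = 0
  | _ => u.1.1 = eta u.2 /\ u.1.2 = - u.2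
  end.

Definition in_C i u : Prop :=
  match val i with
  | 0 => u.2 = 0
  | 1 => u.1.1 = 0
  | _ => u.1.1 + u.1.2 + u.2 = eta u.2
  end.

Lemma mem_SetaI i u : u \in sxI (Seta eta) i <-> in_I i u.
Proof.
case: u => -[x y] z; case: i => [[|[|[|//]]]] lt_i3;
  rewrite /in_I /= (tnth_nth 0%VS) /=; split.
- by case/memv_imgP => w _; rewrite lfunE => -[].
- by case=> -> ->; rewrite -[(x, 0, 0)]/(in1 x) -[in1 x]lfunE memv_img ?memvf.
- by case/memv_imgP => w _; rewrite lfunE => -[].
- by case=> -> ->; rewrite -[(0, 0, z)]/(in3 z) -[in3 z]lfunE memv_img ?memvf.
- by case/memv_imgP => w _; rewrite lfunE => -[-> -> ->]; rewrite linearN opprK.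
case=> -> ->; have -> : (eta z, - z, z) = graph3 eta (- z).
  by rewrite /graph3 linearN !opprK.
by rewrite -[graph3 eta _]lfunE memv_img ?memvf.
Qed.

Lemma mem_SetaC i u : u \in sxC (Seta eta) i <-> in_C i u.
Proof.
case: i => [[|[|[|//]]]] lt_i3; rewrite /in_C /= (tnth_nth 0%VS) /=.
- by split=> /Seta_C1P.
- by split=> /Seta_C2P.
case: u => -[x y] z /=.
split=> [/memv_addP[_ /memv_imgP[s _ ->] [_ /memv_imgP[t _ ->]]] | Cu].
  rewrite !lfunE => -[-> -> ->]; rewrite add0r linearN.
  by rewrite addrACA subrr add0r addrK.
(* The third coordinate determines the argument of graph3, the second one
   then that of in12; the equation is what the first coordinate needs. *)
have -> : (x, y, z) = in12 (- y - z) + graph3 eta (- z).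
  congr (_, _, _); rewrite /= ?add0r ?linearN ?opprK //=.
    by rewrite -Cu -opprD -addrA [RHS]addrC addrK.
  by rewrite opprB opprK [z + y]addrC addrK.
by rewrite memv_add // -[X in X \in _]lfunE memv_img ?memvf.
Qed.

End SetaMembership.

Section BilinearPacking.
Variables (K : fieldType) (V : vectType K).

Lemma biscalar_of (f : V -> V -> K) : bilinear_for *%R *%R f ->
  exists B : {biscalar V}, forall u v, B u v = f u v.
Proof.
move=> fP; pose m := bilinear_isBilinear.Build K V V K *%R *%R f fP.
pose B : bilinear V V *%R *%R := HB.pack f m.
by exists B.
Qed.

(** For a form with a symmetry, linearity in one argument is enough. *)
Lemma hermitian_of (eps : bool) (f : V -> V -> K) :
  (forall w, scalar (f^~ w)) -> (forall u v, f u v = (-1) ^+ eps * f v u) ->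
  exists B : {hermitian V for eps & idfun}, forall u v, B u v = f u v.
Proof.
move=> f_lin f_sym.
have fP : bilinear_for *%R (idfun \; *%R) f.
  split=> w a u v; first exact: f_lin.
  by rewrite f_sym f_lin mulrDr mulrCA -!f_sym.
pose m := bilinear_isBilinear.Build K V V K *%R (idfun \; *%R) f fP.
pose m' := isHermitianSesquilinear.Build K V eps idfun f f_sym.
pose B : {hermitian V for eps & idfun} := HB.pack f m m'.
by exists B.
Qed.

End BilinearPacking.

Section Glue.
Variables (K : fieldType) (U : vectType K) (eta : 'End(U)).
Implicit Types (u v : cube U) (i : 'I_3).

(** The form with the block matrix H_kappa. *)
Definition glue (kappa : U -> U -> K) u v : K :=
  kappa u.1.2 v.1.2 - kappa u.1.1 v.2 - kappa u.2 v.1.1.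

Definition middle (beta : cube U -> cube U -> K) x y := beta (in2 x) (in2 y).

(** 1 - eta is adjoint to eta; equivalently, if 2 is invertible, eta - 1/2 is
    skew-adjoint. *)
Definition complement_adjoint (kappa : U -> U -> K) :=
  forall x y, kappa (eta x) y + kappa x (eta y) = kappa x y.

Definition trivial_radical (V : vectType K) (f : V -> V -> K) :=
  forall x, (forall y, f x y = 0) -> x = 0.

(** Both orders are required because the form that comes from an isomorphism
    with the dual sextuple need not have a symmetry. *)
Definition mutually_orthogonal (beta : cube U -> cube U -> K) :=
  forall i u v, u \in sxI (Seta eta) i -> v \in sxC (Seta eta) i ->
    beta u v = 0 /\ beta v u = 0.

Lemma cube_split (x y z : U) : (x, y, z) = in1 x + in2 y + in3 z :> cube U.
Proof. by congr (_, _, _); rewrite /= ?addr0 ?add0r. Qed.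

Lemma glue_orthogonal (kappa : {biscalar U}) :
  complement_adjoint kappa -> mutually_orthogonal (glue kappa).
Proof.
move=> kE i [[u1 u2] u3] [[v1 v2] v3] /mem_SetaI Iu /mem_SetaC Cv.
case: i Iu Cv => [[|[|[|//]]]] lt_i3; rewrite /in_I /in_C /glue /=.
- by case=> -> -> ->; rewrite !(linear0l, linear0r) !subr0.
- by case=> -> -> ->; rewrite !(linear0l, linear0r) !subr0.
case=> -> -> Cv; have {Cv} -> : v1 = eta v3 - v2 - v3.
  by rewrite -Cv [v1 + v2 + v3 - v2]addrAC !addrK.
rewrite !(linearBl, linearBr, linearNl, linearNr) /=.
have := kE u3 v3; have := kE v3 u3.
by move=> <- <-; split; ring.
Qed.

(** The rigidity on which everything rests.  The pairs (I_1, C_1) and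
    (I_2, C_2) kill all blocks but the three on the antidiagonal.  Pairing I_3
    with the vectors (x, -x, 0) of C_3 identifies the outer blocks with minus
    the middle one, and pairing it with the vectors (eta x - x, 0, x) of C_3
    yields the adjointness condition. *)
Lemma orthogonal_glue (beta : {biscalar (cube U)}) : mutually_orthogonal beta ->
  complement_adjoint (middle beta) /\ forall u v, beta u v = glue (middle beta) u v.
Proof.
move=> orth.
pose o0 : 'I_3 := 0; pose o1 : 'I_3 := 1; pose o2 : 'I_3 := 2.
have I0 x : in1 x \in sxI (Seta eta) o0 by apply/mem_SetaI.
have I1 x : in3 x \in sxI (Seta eta) o1 by apply/mem_SetaI.
have C0 x y : (x, y, 0) \in sxC (Seta eta) o0 by apply/mem_SetaC.
have C1 x y : (0, x, y) \in sxC (Seta eta) o1 by apply/mem_SetaC.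
have I2 x : (eta x, - x, x) \in sxI (Seta eta) o2 by apply/mem_SetaI.
have C2 x : (eta x - x, 0, x) \in sxC (Seta eta) o2.
  by apply/mem_SetaC; rewrite /in_C /= addr0 subrK.
have C2' x : (x, - x, 0) \in sxC (Seta eta) o2.
  by apply/mem_SetaC; rewrite /in_C /= subrr add0r linear0.
have b11 x y : beta (in1 x) (in1 y) = 0 by have [] := orth _ _ _ (I0 x) (C0 y 0).
have b12 x y : beta (in1 x) (in2 y) = 0 by have [] := orth _ _ _ (I0 x) (C0 0 y).
have b21 x y : beta (in2 y) (in1 x) = 0 by have [] := orth _ _ _ (I0 x) (C0 0 y).
have b33 x y : beta (in3 x) (in3 y) = 0 by have [] := orth _ _ _ (I1 x) (C1 0 y).
have b32 x y : beta (in3 x) (in2 y) = 0 by have [] := orth _ _ _ (I1 x) (C1 y 0).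
have b23 x y : beta (in2 y) (in3 x) = 0 by have [] := orth _ _ _ (I1 x) (C1 y 0).
have expand x y z x' y' z' : beta (x, y, z) (x', y', z') =
    beta (in2 y) (in2 y') + beta (in1 x) (in3 z') + beta (in3 z) (in1 x').
  rewrite !cube_split !(linearDl, linearDr) /= b11 b12 b21 b33 b32 b23; ring.
have in2N x : in2 (- x) = - in2 x :> cube U by rewrite linearN.
have b31 x y : beta (in3 x) (in1 y) = - middle beta x y.
  have [] := orth _ _ _ (I2 x) (C2' y).
  rewrite expand !in2N linearNl linearNr !linear0 /= opprK addr0 => /eqP.
  by rewrite addrC addr_eq0 => /eqP.
have b13 x y : beta (in1 x) (in3 y) = - middle beta x y.
  have [_] := orth _ _ _ (I2 y) (C2' x).
  rewrite expand !in2N linearNl linearNr !linear0 linear0l /= opprK addr0 => /eqP.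
  by rewrite addrC addr_eq0 => /eqP.
split=> [x y | [[x y] z] [[x' y'] z']]; last by rewrite expand /glue /= b13 b31.
have [] := orth _ _ _ (I2 x) (C2 y); rewrite expand b13 b31 !linear0 add0r.
rewrite /middle linearB linearBr /= => gl0.
by move=> _; apply/subr0_eq/oppr_inj; rewrite oppr0 -gl0; ring.
Qed.

Lemma glue_trivial_radical (kappa : {biscalar U}) :
  trivial_radical kappa -> trivial_radical (glue kappa).
Proof.
move=> k0 [[x y] z] gl0.
have -> : x = 0.
  apply: k0 => w; have := gl0 (in3 w).
  by rewrite /glue /= !linear0r sub0r subr0 => /eqP; rewrite oppr_eq0 => /eqP.
have -> : y = 0.
  apply: k0 => w; have := gl0 (in2 w).
  by rewrite /glue /= !linear0r !subr0.
have -> // : z = 0.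
apply: k0 => w; have := gl0 (in1 w).
by rewrite /glue /= !linear0r !sub0r oppr0 add0r => /eqP; rewrite oppr_eq0 => /eqP.
Qed.

(** Together with [glue_orthogonal], this says that C_i is exactly the
    orthogonal of I_i: testing against I_i gives the defining equation of C_i
    paired with an arbitrary vector under kappa. *)
Lemma glue_perpI (kappa : {biscalar U}) i v :
  trivial_radical kappa -> complement_adjoint kappa ->
  (forall u, u \in sxI (Seta eta) i -> glue kappa v u = 0) ->
  v \in sxC (Seta eta) i.
Proof.
move=> k0 kE perp; apply/mem_SetaC; case: i perp => [[|[|[|//]]]] lt_i3 perp;
  rewrite /in_C /=; case: v perp => -[v1 v2] v3 perp /=.
- apply: k0 => y; have /mem_SetaI/perp : in_I eta (Ordinal lt_i3) (in1 y) by [].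
  by rewrite /glue /= !linear0r !sub0r oppr0 add0r => /eqP; rewrite oppr_eq0 => /eqP.
- apply: k0 => y; have /mem_SetaI/perp : in_I eta (Ordinal lt_i3) (in3 y) by [].
  by rewrite /glue /= !linear0r sub0r subr0 => /eqP; rewrite oppr_eq0 => /eqP.
apply/eqP; rewrite -subr_eq0; apply/eqP; apply: k0 => y.
have /mem_SetaI/perp : in_I eta (Ordinal lt_i3) (eta y, - y, y) by [].
rewrite /glue /= linearBl !linearDl !linearNr /= -[kappa v3 y]kE.
by move=> gl0; apply: oppr_inj; rewrite oppr0 -gl0; ring.
Qed.

(** The mirror image of [glue_perpI], with the roles of I_i and C_i exchanged;
    a functional vanishing on C_i comes from I_i. *)
Lemma glue_perpC (kappa : {biscalar U}) i u :
  trivial_radical kappa -> complement_adjoint kappa ->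
  (forall v, v \in sxC (Seta eta) i -> glue kappa u v = 0) ->
  u \in sxI (Seta eta) i.
Proof.
move=> k0 kE perp; apply/mem_SetaI; case: i perp => [[|[|[|//]]]] lt_i3 perp;
  rewrite /in_I /=; case: u perp => -[u1 u2] u3 perp /=.
- split; apply: k0 => y.
    have /mem_SetaC/perp : in_C eta (Ordinal lt_i3) (in2 y) by [].
    by rewrite /glue /= !linear0r !subr0.
  have /mem_SetaC/perp : in_C eta (Ordinal lt_i3) (in1 y) by [].
  by rewrite /glue /= !linear0r !sub0r oppr0 add0r => /eqP; rewrite oppr_eq0 => /eqP.
- split; apply: k0 => y.
    have /mem_SetaC/perp : in_C eta (Ordinal lt_i3) (in3 y) by [].
    by rewrite /glue /= !linear0r sub0r subr0 => /eqP; rewrite oppr_eq0 => /eqP.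
  have /mem_SetaC/perp : in_C eta (Ordinal lt_i3) (in2 y) by [].
  by rewrite /glue /= !linear0r !subr0.
have Du2 : u2 = - u3.
  apply/eqP; rewrite -addr_eq0; apply/eqP; apply: k0 => y.
  have /mem_SetaC/perp : in_C eta (Ordinal lt_i3) (in12 (- y)).
    by rewrite /in_C /= opprK addNr add0r linear0.
  rewrite /glue /= linear0r linearDl opprK linearNr /= => <-; ring.
split=> //; apply/eqP; rewrite -subr_eq0; apply/eqP; apply: k0 => y.
have /mem_SetaC/perp : in_C eta (Ordinal lt_i3) (eta y, - y, y).
  by rewrite /in_C /= subrK.
rewrite /glue /= Du2 linearBl linearNl linearNr /= -[kappa u3 y]kE.
by move=> gl0; apply: oppr_inj; rewrite oppr0 -gl0; ring.
Qed.

End Glue.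

Section CompatibleForms.
Variables (K : fieldType) (U : vectType K) (eta : 'End(U)) (eps : bool).

Lemma nondegenerateP (V : vectType K) (B : {hermitian V for eps & idfun}) :
  reflect (trivial_radical B) (nondegenerate B).
Proof.
apply: (iffP eqP) => [rad0 x Bx | rad0].
  by apply/eqP; rewrite -memv0 -rad0; apply/mem_orthovP => v _.
apply/eqP; rewrite -subv0; apply/subvP => x /mem_orthovP Bx.
by rewrite memv0 [x]rad0 // => y; rewrite Bx ?memvf.
Qed.

Lemma compatible_glue (B : {hermitian (cube U) for eps & idfun}) :
  compatible_form (Seta eta) B ->
  exists kappa : {hermitian U for eps & idfun},
    [/\ trivial_radical kappa, complement_adjoint eta kappa
      & forall u v, B u v = glue kappa u v].
Proof.
case=> /nondegenerateP B0 BC.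
have [|kE Bglue] := @orthogonal_glue K U eta B.
  move=> i u v Iu; rewrite BC => /mem_orthovP/(_ u Iu) Bvu.
  by split=> //; apply/eqP; rewrite herm_eq0C Bvu.
have [||kappa Dk] := @hermitian_of K U eps (middle B).
- by move=> w a u v; rewrite /middle linearP linearDl linearZl_LR.
- by move=> u v; rewrite /middle hermC.
exists kappa; split=> [x kx | x y | u v]; last by rewrite Bglue /glue !Dk.
  have: in2 x = 0 :> cube U.
    by apply: B0 => w; rewrite Bglue /glue -!Dk kx !linear0l !subr0.
  by move/(congr1 (fun w : cube U => w.1.2)).
by rewrite !Dk.
Qed.

Lemma glue_compatible (kappa : {hermitian U for eps & idfun}) :
  trivial_radical kappa -> complement_adjoint eta kappa ->
  exists2 B : {hermitian (cube U) for eps & idfun},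
    compatible_form (Seta eta) B & forall u v, B u v = glue kappa u v.
Proof.
move=> k0 kE; have [||B DB] := @hermitian_of K (cube U) eps (glue kappa).
- move=> w a u v; rewrite /glue /= !linearDl !linearZl_LR /=; ring.
- move=> u v; rewrite /glue [kappa u.1.2 _]hermC [kappa u.1.1 _]hermC.
  rewrite [kappa u.2 _]hermC /=; ring.
exists B => //; split.
  apply/nondegenerateP => x Bx; apply: (@glue_trivial_radical _ _ kappa) => // y.
  by rewrite -DB.
move=> i; apply/vspaceP => v; apply/idP/mem_orthovP => [Cv u Iu | perp].
  by rewrite DB; have [] := @glue_orthogonal _ _ eta kappa kE i u v Iu Cv.
by apply: (@glue_perpI _ _ eta kappa) => // u Iu; rewrite -DB perp.
Qed.

End CompatibleForms.

Section Automorphisms.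
Variables (K : fieldType) (U : vectType K) (eta : 'End(U)).

Definition cube_map (g : 'End(U)) (u : cube U) : cube U :=
  (g u.1.1, g u.1.2, g u.2).

Fact cube_map_is_linear g : linear (cube_map g).
Proof. by move=> a u v; rewrite /cube_map /= !linearP. Qed.

HB.instance Definition _ g :=
  GRing.isLinear.Build K (cube U) (cube U) _ (cube_map g) (cube_map_is_linear g).

Lemma cube_map_iso (g : 'End(U)) : injective g -> (forall x, g (eta x) = eta (g x)) ->
  sextuple_iso (Seta eta) (Seta eta) (linfun (cube_map g)).
Proof.
move=> /lker0P g_inj gE.
have gK := lker0_lfunK g_inj; have gVK := lker0_lfunVK g_inj.
have fK : cancel (cube_map g) (cube_map g^-1%VF).
  by case=> -[x y] z; rewrite /cube_map /= !gK.
have fVK : cancel (cube_map g^-1%VF) (cube_map g).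
  by case=> -[x y] z; rewrite /cube_map /= !gVK.
have gI := can_inj gK.
have g0 x : g x = 0 -> x = 0 by move=> gx0; apply: gI; rewrite gx0 linear0.
have img (W : {vspace cube U}) (P : cube U -> Prop) :
    (forall u, u \in W <-> P u) -> (forall u, P (cube_map g u) <-> P u) ->
  (linfun (cube_map g) @: W)%VS = W.
  move=> WP Pg; apply/vspaceP => v; apply/memv_imgP/idP => [[u /WP Wu ->] | /WP Wv].
    by rewrite lfunE; apply/WP/Pg.
  by exists (cube_map g^-1%VF v); rewrite ?lfunE /= ?fVK //; apply/WP/Pg; rewrite fVK.
split=> [|i|i].
- by exists (cube_map g^-1%VF) => u; rewrite lfunE /= ?fK ?fVK.
- apply: img => [u|[[x y] z]]; first exact: mem_SetaI.
  case: i => [[|[|[|//]]]] lt_i3; rewrite /in_I /=.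
  + by split=> -[]; [move=> /g0-> /g0-> | move=> -> ->; rewrite linear0].
  + by split=> -[]; [move=> /g0-> /g0-> | move=> -> ->; rewrite linear0].
  rewrite -gE -linearN; by split=> -[]; [move=> /gI-> /gI-> | move=> -> ->].
apply: img => [u|[[x y] z]]; first exact: mem_SetaC.
case: i => [[|[|[|//]]]] lt_i3; rewrite /in_C /=.
- by split=> [/g0|->] //; rewrite linear0.
- by split=> [/g0|->] //; rewrite linear0.
by rewrite -gE -!linearD; split=> [/gI|->].
Qed.

(** An automorphism preserves I_1, I_2 and the intersection of C_1 and C_2,
    which are the three summands, hence is diagonal.  The vectors (x, -x, 0) of
    C_3 identify its first two components, and I_3 identifies the last two and
    makes their common value commute with eta. *)
Lemma Seta_automorphism f : sextuple_iso (Seta eta) (Seta eta) f ->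
  exists2 g : 'End(U), forall x, g (eta x) = eta (g x)
    & forall u, f u = cube_map g u.
Proof.
case=> _ fI fC.
have Ii i u : in_I eta i u -> in_I eta i (f u).
  by move=> /mem_SetaI Iu; apply/mem_SetaI; rewrite -fI memv_img.
have Ci i u : in_C eta i u -> in_C eta i (f u).
  by move=> /mem_SetaC Iu; apply/mem_SetaC; rewrite -fC memv_img.
(* The middle component of f (0, x, 0). *)
pose g : 'End(U) := linfun (snd \o fst \o f \o @in2 K U).
have gE x : g x = (f (in2 x)).1.2 by rewrite lfunE.
have fD u v : f (u + v) = f u + f v by exact: linearD.
have fB u v : f (u - v) = f u - f v by exact: linearB.
have f2 x : f (in2 x) = in2 (g x).
  have := Ci 0 (in2 x) erefl; have := Ci 1 (in2 x) erefl; rewrite gE /in_C /=.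
  by case: (f (in2 x)) => -[a b] c /= -> ->.
have f1 x : f (in1 x) = in1 (g x).
  have := Ci 2 (in12 x); have := Ii 0 (in1 x); rewrite /in_I /in_C /=.
  have -> : in12 x = in1 x - in2 x :> cube U.
    by congr (_, _, _); rewrite /= ?subr0 ?sub0r.
  rewrite fB f2; case: (f (in1 x)) => -[a b] c /= [] // -> ->.
  rewrite !subr0 sub0r !addr0 !linear0 subrr => /(_ erefl)/subr0_eq->.
  by [].
have f3 x : f (in3 x) = in3 (g x) /\ g (eta x) = eta (g x).
  have := Ii 2 (in1 (eta x) - in2 x + in3 x); have := Ii 1 (in3 x).
  rewrite /in_I /= fD fB f1 f2; case: (f (in3 x)) => -[a b] c /= [] // -> ->.
  rewrite !(sub0r, subr0, addr0, add0r, oppr0).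
  by move=> /(_ (conj erefl erefl))[-> /oppr_inj->].
exists g => [x|[[x y] z]]; first by have [] := f3 x.
rewrite cube_split !fD f1 f2 (f3 z).1 /=.
by congr (_, _, _); rewrite /= ?addr0 ?add0r.
Qed.

End Automorphisms.

(** * Self-duality *)

Section SelfDuality.
Variables (K : fieldType) (U : vectType K) (eta : 'End(U)).

(** An isomorphism f onto the dual sextuple is read as the bilinear form
    f u v: it maps I_i to the annihilator of C_i and C_i to the annihilator of
    I_i, which is mutual orthogonality. *)
Lemma dual_iso_glue f : sextuple_iso (Seta eta) (dual_sextuple (Seta eta)) f ->
  exists2 kappa : {biscalar U},
    trivial_radical kappa & complement_adjoint eta kappa.
Proof.
case=> f_bij fI fC.
pose b u v := (f u : 'Hom(cube U, K^o)) v.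
have [|beta Db] := @biscalar_of K (cube U) b.
  split=> w a u v; rewrite /b /=; last by rewrite linearP.
  by rewrite linearP /= add_lfunE scale_lfunE.
have [|kE beta_glue] := @orthogonal_glue K U eta beta.
  move=> i u v Iu Cv; rewrite !Db /b; split.
    have: f u \in sxI (dual_sextuple (Seta eta)) i by rewrite -fI memv_img.
    by move/annihilatorP; apply.
  have: f v \in sxC (dual_sextuple (Seta eta)) i by rewrite -fC memv_img.
  by move/annihilatorP; apply.
have [|kappa Dk] := @biscalar_of K U (middle beta).
  split=> w a u v; rewrite /middle linearP.
    by rewrite linearDl linearZl_LR.
  by rewrite linearDr linearZr_LR.
exists kappa => [x kx | x y]; last by rewrite !Dk.
have: in2 x = 0 :> cube U.
  apply: (bij_inj f_bij); rewrite linear0; apply/lfunP => w.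
  by rewrite zero_lfunE -[LHS]/(b _ _) -Db beta_glue /glue -!Dk kx !linear0l !subr0.
by move/(congr1 (fun w : cube U => w.1.2)).
Qed.

(** Conversely, u |-> glue kappa u is injective, hence bijective by dimension,
    and the two perpendicularity lemmas identify the images. *)
Lemma glue_dual_iso (kappa : {biscalar U}) :
  trivial_radical kappa -> complement_adjoint eta kappa ->
  isomorphic (Seta eta) (dual_sextuple (Seta eta)).
Proof.
move=> k0 kE.
have [|beta Db] := @biscalar_of K (cube U) (glue kappa).
  split=> w a u v; rewrite /glue /=.
    rewrite !linearDl !linearZl_LR /=; ring.
  rewrite !linearDr !linearZr_LR /=; ring.
pose F (u : cube U) : dual_space (cube U) := linfun (beta u : cube U -> K^o).
have FE u v : (F u : 'Hom(cube U, K^o)) v = glue kappa u v by rewrite lfunE /= Db.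
have F_lin : linear F.
  move=> a u v; apply/lfunP => w.
  by rewrite add_lfunE scale_lfunE !FE -!Db linearDl linearZl_LR.
pose Fm := GRing.isLinear.Build K (cube U) (dual_space (cube U)) _ F F_lin.
pose FL : {linear (cube U) -> (dual_space (cube U))} := HB.pack F Fm.
pose f : 'Hom(cube U, dual_space (cube U)) := linfun FL.
have fE u v : (f u : 'Hom(cube U, K^o)) v = glue kappa u v by rewrite lfunE FE.
have f_inj : lker f == 0%VS.
  rewrite -subv0; apply/subvP => u; rewrite memv_ker memv0 => /eqP fu0.
  apply/eqP/(glue_trivial_radical k0) => v.
  by rewrite -fE fu0 zero_lfunE.
have f_surj : limg f = fullv.
  apply/eqP; rewrite eqEdim subvf limg_dim_eq ?(eqP f_inj) ?capv0 //=.
  by rewrite !dimvf eq_leq //; apply: muln1.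
have f_im (W : {vspace cube U}) (W' : {vspace dual_space (cube U)}) :
    (forall u, f u \in W' <-> u \in W) -> (f @: W)%VS = W'.
  move=> WW'; apply/vspaceP => h; apply/memv_imgP/idP => [[u Wu ->] | W'h].
    exact/WW'.
  have: h \in limg f by rewrite f_surj memvf.
  by case/memv_imgP => u _ Dh; exists u => //; apply/WW'; rewrite -Dh.
exists f; split=> [|i|i].
- exists (f^-1)%VF => u; first by rewrite lker0_lfunK.
  by rewrite limg_lfunVK // f_surj memvf.
- apply: f_im => u; split=> [/annihilatorP uC | Iu].
    by apply: (glue_perpC k0 kE) => v Cv; rewrite -fE uC.
  apply/annihilatorP => v Cv; rewrite fE.
  by have [] := @glue_orthogonal _ _ eta kappa kE i u v Iu Cv.
apply: f_im => u; split=> [/annihilatorP uI | Cu].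
  by apply: (glue_perpI k0 kE) => v Iv; rewrite -fE uI.
apply/annihilatorP => v Iv; rewrite fE.
by have [] := @glue_orthogonal _ _ eta kappa kE i v u Iv Cu.
Qed.

(** For an eigenvector x, adjointness says that the linear form kappa x is
    multiplied by 1 - 2 lambda when composed with eta - lambda.  The latter is
    nilpotent and kappa x is not 0. *)
Lemma complement_adjoint_eigenvalue (kappa : {biscalar U}) lambda :
  indecomposable_end eta -> passmx.leigenvalue eta lambda ->
  trivial_radical kappa -> complement_adjoint eta kappa -> lambda = 2%:R^-1.
Proof.
move=> indec eig k0 kE; have [n nil_n] := indecomposable_nilpotent indec eig.
pose x := vpick (passmx.leigenspace eta lambda).
have nz_x : x != 0 by rewrite vpick0.
have eta_x : eta x = lambda *: x.
  have := memv_pick (passmx.leigenspace eta lambda).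
  rewrite memv_ker add_lfunE opp_lfunE scale_lfunE id_lfunE subr_eq0.
  by move/eqP.
have kx m y : kappa x (iter m (eta - lambda *: \1%VF) y) =
    (1 - 2%:R * lambda) ^+ m * kappa x y.
  elim: m y => [|m IHm] y; first by rewrite mul1r.
  rewrite iterSr IHm exprSr -mulrA; congr (_ * _).
  rewrite add_lfunE opp_lfunE scale_lfunE id_lfunE linearBr linearZr_LR /=.
  rewrite mulrBl mul1r -[X in _ = X - _]kE eta_x linearZl_LR /=; ring.
have: (1 - 2%:R * lambda) ^+ n == 0.
  apply: contraNT nz_x => nz; apply/eqP/k0 => y.
  by apply: (mulfI nz); rewrite -kx nil_n linear0r mulr0.
rewrite expf_eq0 subr_eq0 => /andP[_ /eqP l2].
have nz2 : (2%:R : K) != 0.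
  by apply/eqP => z2; move/eqP: l2; rewrite z2 mul0r oner_eq0.
by apply: (mulfI nz2); rewrite -l2 divff.
Qed.

End SelfDuality.

(** * The matrices N, M and Q *)

Lemma two_neq0 (K : fieldType) : 2%N \notin [pchar K] -> (2%:R : K) != 0.
Proof. by apply: contra => /eqP K2; rewrite inE /= K2 eqxx. Qed.

Section JordanMatrices.
Variables (K : fieldType) (k : nat).
Implicit Types (A P Q W : 'M[K]_k) (a : nat -> K).

Lemma MmxE (i j : 'I_k) :
  Mmx k i j = if (i + j).+1 == k then (-1) ^+ j else 0 :> K.
Proof.
rewrite mxE !addn1 !exprS mulrA mulN1r opprK mul1r; congr (if _ then _ else _).
by have := ltn_ord i; have := ltn_ord j; lia.
Qed.

Lemma tr_Mmx : (Mmx k)^T = (-1) ^+ (~~ odd k) *: Mmx k :> 'M[K]_k.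
Proof.
apply/matrixP => i j; rewrite [LHS]mxE MmxE addnC [RHS]mxE MmxE.
case: eqP => [Ek|_]; last by rewrite mulr0.
rewrite -exprD -[LHS]signr_odd -[RHS]signr_odd oddD oddb.
have -> : ~~ odd k = odd i (+) odd j by lia.
by rewrite -addbA addbb addbF.
Qed.

(** M is its own inverse up to sign, which makes it invertible. *)
Lemma Mmx_sqr : Mmx k *m Mmx k = (-1) ^+ (~~ odd k) *: 1%:M :> 'M[K]_k.
Proof.
apply/matrixP => i j; rewrite !mxE.
rewrite (bigD1 (rev_ord i)) //= big1 => [|l]; last first.
  rewrite -val_eqE /= MmxE => ne_l.
  by case: eqP => [|_]; [have := ltn_ord i; lia | rewrite mul0r].
have lt_ik := ltn_ord i; rewrite addr0 !MmxE /=.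
have -> : (i + (k - i.+1)).+1 = k by lia.
rewrite eqxx; case: (eqVneq i j) => [<-|/eqP ne_ij].
  have -> : ((k - i.+1) + i).+1 = k by lia.
  rewrite eqxx -exprD mulr1 -[LHS]signr_odd.
  by have -> : odd (k - i.+1 + i) = ~~ odd k by lia.
case: eqP => [E|_]; last by rewrite !mulr0.
by case: ne_ij; apply: val_inj => /=; lia.
Qed.

Lemma Mmx_unit : Mmx k \in @unitmx K k.
Proof.
have : (-1) ^+ (~~ odd k) *: 1%:M \in @unitmx K k.
  by rewrite scalemx1 unitmxE det_scalar unitrX // unitrX // unitrN1.
by rewrite -Mmx_sqr unitmx_mul => /andP[].
Qed.

(** N^T shifts M down and N shifts it to the right.  Both results live on the
    antidiagonal i + j = k (counting from 0), where they differ by the sign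
    between neighbouring columns of M. *)
Lemma tr_Nmx_Mmx : (Nmx k)^T *m Mmx k = - (Mmx k *m Nmx k) :> 'M[K]_k.
Proof.
apply/matrixP => i j; rewrite !mxE.
have lt_ik := ltn_ord i; have lt_jk := ltn_ord j.
case Dij: (i + j == k)%N; last first.
  by rewrite !big1 ?oppr0 // => l _; rewrite !mxE; have lt_lk := ltn_ord l;
    do 2![case: eqP => ?]; rewrite ?(mul0r, mulr0) //; lia.
have lt_i : (i.-1 < k)%N by lia.
have lt_j : (j.-1 < k)%N by lia.
rewrite (bigD1 (Ordinal lt_i)) //= big1 => [|l]; last first.
  rewrite -val_eqE /= => ?; rewrite !mxE; case: eqP => ?; rewrite ?mul0r //.
  by lia.
rewrite (bigD1 (Ordinal lt_j)) //= big1 => [|l]; last first.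
  rewrite -val_eqE /= => ?; rewrite !mxE; case: (nat_of_ord j =P l.+1) => ?; rewrite ?mulr0 //.
  by lia.
rewrite !MmxE !mxE /= !addr0.
have -> : (i.-1 + j).+1 == k by lia.
have -> : (i + j.-1).+1 == k by lia.
have -> : i == i.-1.+1 :> nat by lia.
have -> : j == j.-1.+1 :> nat by lia.
rewrite mul1r mulr1; have -> : j = j.-1.+1 :> nat by lia.
by rewrite exprS mulN1r.
Qed.

Lemma Nmx_mulE A (i j : 'I_k) (lt_i : (i.+1 < k)%N) :
  (Nmx k *m A) i j = A (Ordinal lt_i) j.
Proof.
rewrite mxE (bigD1 (Ordinal lt_i)) //= big1 => [|l].
  by rewrite mxE eqxx mul1r addr0.
by rewrite -val_eqE /= mxE => /negPf->; rewrite mul0r.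
Qed.

(** The default value of insubd is never reached, since j.-1 < k. *)
Lemma mul_NmxE A (i j : 'I_k) :
  (A *m Nmx k) i j = if j == 0%N :> nat then 0 else A i (insubd j j.-1).
Proof.
have lt_j : (j.-1 < k)%N by have := ltn_ord j; lia.
rewrite mxE; case: eqP => [j0|/eqP j_gt0].
  by rewrite big1 // => l _; rewrite mxE j0 mulr0.
have -> : insubd j j.-1 = Ordinal lt_j by apply: val_inj; rewrite /= val_insubd lt_j.
rewrite (bigD1 (Ordinal lt_j)) //= big1 => [|l].
  by rewrite mxE /= prednK ?lt0n // eqxx mulr1 addr0.
rewrite -val_eqE /= mxE => ne_l; case: (nat_of_ord j =P l.+1) => [Ej|]; rewrite ?mulr0 //.
by move: ne_l; rewrite Ej eqxx.
Qed.

Lemma NmxXE n (i j : 'I_k) : (Nmx k ^+ n) i j = (j == n + i :> nat)%N%:R :> K.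
Proof.
elim: n i j => [|n IHn] i j; first by rewrite expr0 mxE eq_sym.
rewrite exprS -mulmxE; case: (ltnP i.+1 k) => [lt_i | ge_i].
  by rewrite (Nmx_mulE _ _ lt_i) IHn /= addnS.
rewrite mxE big1 => [|l _].
  by case: eqP => // ?; have := ltn_ord j; lia.
by rewrite mxE; case: eqP => ?; rewrite ?mul0r //; have := ltn_ord l; lia.
Qed.

Lemma QmxE a (i j : 'I_k) : Qmx k a i j = if (i <= j)%N then a (j - i)%N else 0.
Proof.
have lt_jk := ltn_ord j.
rewrite summxE; case: leqP => [le_ij | lt_ji].
  have lt_d : (j - i < k)%N by lia.
  rewrite (bigD1 (Ordinal lt_d)) //= big1 => [|l].
    by rewrite mxE NmxXE /= subnK // eqxx mulr1 addr0.
  rewrite -val_eqE /= mxE NmxXE => ?; case: eqP => ?; rewrite ?mulr0 //.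
  by lia.
by rewrite big1 // => l _; rewrite mxE NmxXE; case: eqP => ?; rewrite ?mulr0 //; lia.
Qed.

Lemma comm_Qmx_Nmx a : Qmx k a *m Nmx k = Nmx k *m Qmx k a.
Proof.
rewrite mulmx_suml mulmx_sumr; apply: eq_bigr => i _.
by rewrite -scalemxAl -scalemxAr !mulmxE -exprSr -exprS.
Qed.

(** The centralizer of N consists of the polynomials in N: comparing entries
    of Q N and N Q shows that Q is constant along diagonals, so that its first
    row holds the coefficients. *)
Lemma comm_NmxP Q (k_gt0 : (0 < k)%N) :
  Q *m Nmx k = Nmx k *m Q ->
  Q = Qmx k (fun n => Q (Ordinal k_gt0) (insubd (Ordinal k_gt0) n)).
Proof.
move=> QN; apply/matrixP => i j; rewrite QmxE.
case: i => i; elim: i j => [|i IHi] j lt_i.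
  rewrite leq0n subn0; congr (Q _ _); apply: val_inj => //=.
  by rewrite val_insubd ltn_ord.
have lt_i' := ltnW lt_i.
have := congr1 (fun A : 'M_k => A (Ordinal lt_i') j) QN.
rewrite (@Nmx_mulE Q (Ordinal lt_i') j lt_i) => <-; rewrite mul_NmxE.
case: (nat_of_ord j =P 0%N) => [-> //|/eqP j_gt0].
have lt_j : (j.-1 < k)%N by have := ltn_ord j; lia.
rewrite IHi /= val_insubd lt_j.
have -> : (i <= j.-1)%N = (i.+1 <= j)%N by lia.
by have -> : (j.-1 - i = j - i.+1)%N by lia.
Qed.

(** Transposition with respect to M sends N to - N, hence Q(N) to Q(- N). *)
Lemma tr_Qmx_Mmx a :
  (Qmx k a)^T *m Mmx k = Mmx k *m Qmx k (fun n => (-1) ^+ n * a n).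
Proof.
have NX n : (Nmx k ^+ n)^T *m Mmx k = (-1) ^+ n *: (Mmx k *m Nmx k ^+ n) :> 'M[K]_k.
  elim: n => [|n IHn]; first by rewrite !expr0 scale1r trmx1 mul1mx mulmx1.
  rewrite exprSr -mulmxE trmx_mul -mulmxA IHn -scalemxAr !mulmxA tr_Nmx_Mmx.
  rewrite mulNmx scalerN [in RHS]exprS mulN1r scaleNr -!mulmxA.
  by congr (- (_ *: (_ *m _))); rewrite !mulmxE -exprS -exprSr.
rewrite linear_sum mulmx_suml mulmx_sumr; apply: eq_bigr => n _.
by rewrite linearZ /= -scalemxAl NX -scalemxAr !scalerA mulrC.
Qed.

Lemma tr_even_Qmx_Mmx a : (forall i, (i < k)%N -> odd i -> a i = 0) ->
  (Qmx k a)^T *m Mmx k = Mmx k *m Qmx k a.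
Proof.
move=> a_odd; rewrite tr_Qmx_Mmx; congr (_ *m _).
apply: eq_bigr => i _; congr (_ *: _); rewrite -signr_odd.
by case odd_i: (odd i); rewrite ?mul1r // a_odd ?mulr0.
Qed.

Lemma det_Qmx a : \det (Qmx k a) = a 0%N ^+ k.
Proof.
rewrite -det_tr det_trig.
  rewrite (eq_bigr (fun _ => a 0%N)) => [|i _]; first by rewrite prodr_const card_ord.
  by rewrite mxE QmxE leqnn subnn.
by apply/is_trig_mxP => i j lt_ij; rewrite mxE QmxE leqNgt lt_ij.
Qed.

Lemma Qmx_unit a : (0 < k)%N -> (Qmx k a \in unitmx) = (a 0%N != 0).
Proof. by move=> k_gt0; rewrite unitmxE det_Qmx unitfE expf_eq0 k_gt0. Qed.

Lemma Qmx_inj a b : Qmx k a = Qmx k b -> forall i, (i < k)%N -> a i = b i.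
Proof.
move=> eq_ab i lt_ik; have k_gt0 : (0 < k)%N by apply: leq_trans lt_ik.
have := congr1 (fun A : 'M_k => A (Ordinal k_gt0) (Ordinal lt_ik)) eq_ab.
by rewrite !QmxE leq0n subn0.
Qed.

End JordanMatrices.

(** The square root of 1 + X as a truncated power series, found one
    coefficient at a time.  Only the existence of the truncations is needed, and they are
    easier to handle as polynomials with an explicit remainder. *)
Lemma sqrt_1pX (K : fieldType) (m : nat) : 2%N \notin [pchar K] ->
  exists p r : {poly K}, p ^+ 2 = 1 + 'X + 'X^(m.+1) * r.
Proof.
move=> K2; have nz2 := two_neq0 K2.
suff [p [r [Dp _]]] : exists p r : {poly K},
  p ^+ 2 = 1 + 'X + 'X^(m.+1) * r /\ p`_0 = 1.
  by exists p, r.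
elim: m => [|m [p [r [Dp p0]]]].
  by exists 1, (- 1); rewrite expr1n expr1 mulrN1 addrK coef1.
(* Replacing p by p - c X^(m+1) changes p^2 by - 2 c p X^(m+1) up to higher
   order; as p has constant term 1, this value of c cancels the constant term
   of r. *)
set c := r`_0 / 2%:R.
have /factor_theorem [s] : root (r - 2%:R *: (c *: p)) 0.
  rewrite /root horner_coef0 !(coefB, coefZ) p0 mulr1.
  by rewrite /c mulrC divfK // subrr.
rewrite polyC0 subr0 => Ds.
exists (p - c *: 'X^(m.+1)), (s + (c ^+ 2) *: 'X^m).
split; last by rewrite coefB coefZ coefXn mulr0 subr0.
have -> : (p - c *: 'X^(m.+1)) ^+ 2 =
   p ^+ 2 - 'X^(m.+1) * (2%:R *: (c *: p)) + (c ^+ 2) *: 'X^(m.+1) * 'X^(m.+1).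
  rewrite -!mul_polyC !rmorphXn /=; ring.
rewrite Dp !exprS -!mul_polyC.
have -> : 2%:R%:P * (c%:P * p) = r - s * 'X by rewrite -Ds -!mul_polyC; ring.
ring.
Qed.

Lemma strict_upper_exp (K : fieldType) (k m : nat) (W : 'M[K]_k) :
    (forall i j : 'I_k, (j <= i)%N -> W i j = 0) ->
  forall i j : 'I_k, (j < i + m)%N -> (W ^+ m) i j = 0.
Proof.
move=> W0; elim: m => [|m IHm] i j lt_ji.
  by rewrite expr0 mxE; case: eqP => // Eij; move: lt_ji; rewrite Eij addn0 ltnn.
rewrite exprS -mulmxE mxE big1 // => l _.
case: (leqP l i) => [le_li | lt_il]; first by rewrite W0 ?mul0r.
by rewrite IHm ?mulr0 //; lia.
Qed.

(** A strictly upper triangular W is nilpotent, so 1 + W has a square root that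
    is a polynomial in W.  Being a polynomial in W, it inherits from W both the
    self-adjointness for M and the commutation with N. *)
Lemma unipotent_sqrt (K : fieldType) (k : nat) (W M N : 'M[K]_k) :
    2%N \notin [pchar K] -> (forall i j : 'I_k, (j <= i)%N -> W i j = 0) ->
    W^T *m M = M *m W -> W *m N = N *m W ->
  exists P, [/\ P *m P = 1%:M + W, P^T *m M = M *m P & P *m N = N *m P].
Proof.
move=> K2; case: k W M N => [|n] W M N W0 MW WN.
  by exists 0; split; rewrite [LHS]flatmx0 [RHS]flatmx0.
have Wn : W ^+ n.+1 = 0.
  apply/matrixP => i j; rewrite (strict_upper_exp W0) ?mxE //.
  by have := ltn_ord j; lia.
have [p [r Dp]] := sqrt_1pX n K2; exists (horner_mx W p); split.
- rewrite mulmxE -expr2 -rmorphXn Dp !rmorphD rmorph1 rmorphM rmorphXn /=.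
  by rewrite horner_mx_X Wn mul0r addr0.
- elim/poly_ind: p {Dp} => [|p c IHp]; first by rewrite rmorph0 trmx0 mul0mx mulmx0.
  rewrite rmorphD rmorphM /= horner_mx_X horner_mx_C linearD /= mulmxDl mulmxDr.
  rewrite tr_scalar_mx mul_scalar_mx mul_mx_scalar; congr (_ + _).
  have PW : horner_mx W p * W = W * horner_mx W p by exact: comm_horner_mx.
  by rewrite {1}PW -!mulmxE trmx_mul -mulmxA MW !mulmxA IHp.
- exact: comm_horner_mx.
Qed.

Section GramMatrices.
Variables (K : fieldType) (k : nat).
Hypotheses (K_char : 2%N \notin [pchar K]) (k_gt0 : (0 < k)%N).

Let nz2 : (2%:R : K) != 0. Proof. exact: two_neq0. Qed.

(** The Gram matrices of the compatible forms, when eta has eigenvalue 1/2 and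
    the basis is a Jordan basis. *)
Definition jordan_gram (eps : bool) (A : 'M[K]_k) :=
  [/\ A \in unitmx, A^T = (-1) ^+ eps *: A & (Nmx k)^T *m A = - (A *m Nmx k)].

Lemma MQ_jordan_gram (a : nat -> K) : a 0%N != 0 ->
  (forall i, (i < k)%N -> odd i -> a i = 0) ->
  jordan_gram (~~ odd k) (Mmx k *m Qmx k a).
Proof.
move=> a0 a_odd; split; first by rewrite unitmx_mul Mmx_unit Qmx_unit.
  by rewrite trmx_mul tr_Mmx -scalemxAr tr_even_Qmx_Mmx.
by rewrite mulmxA tr_Nmx_Mmx mulNmx -!mulmxA comm_Qmx_Nmx.
Qed.

Lemma Mmx_jordan_gram : jordan_gram (~~ odd k) (Mmx k).
Proof. by split; [apply: Mmx_unit | apply: tr_Mmx | apply: tr_Nmx_Mmx]. Qed.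

(** A = M Q with Q in the centralizer of N.  The symmetry of A means
    Q(- N) = s Q(N) for a sign s that is 1 precisely when A and M have the same
    symmetry; the non-zero constant term of Q excludes s = -1, and s = 1 kills
    the odd coefficients. *)
Lemma jordan_gramP eps A : jordan_gram eps A ->
  eps = ~~ odd k /\ exists2 a : nat -> K,
    a 0%N != 0 /\ (forall i, (i < k)%N -> odd i -> a i = 0)
    & A = Mmx k *m Qmx k a.
Proof.
case=> A_unit trA NA; have [Q DA] : exists Q, A = Mmx k *m Q.
  by exists (invmx (Mmx k) *m A); rewrite mulKVmx ?Mmx_unit.
have QN : Q *m Nmx k = Nmx k *m Q.
  apply: (can_inj (mulKmx (Mmx_unit K k))).
  rewrite !mulmxA -DA; apply: oppr_inj.
  by rewrite -NA [in LHS]DA mulmxA tr_Nmx_Mmx mulNmx.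
move: DA; rewrite (comm_NmxP k_gt0 QN); set a := fun n => _ => DA.
have a0 : a 0%N != 0.
  by move: A_unit; rewrite -(Qmx_unit a k_gt0) DA unitmx_mul => /andP[].
pose s : K := (-1) ^+ (~~ odd k (+) eps).
have sQ : Qmx k (fun n => (-1) ^+ n * a n) = Qmx k (fun n => s * a n).
  apply: (can_inj (mulKmx (Mmx_unit K k))); rewrite -tr_Qmx_Mmx.
  have -> : Qmx k (fun n => s * a n) = s *: Qmx k a.
    by rewrite scaler_sumr; apply: eq_bigr => n _; rewrite scalerA.
  rewrite -scalemxAr -DA /s signr_addb -scalerA -trA DA trmx_mul tr_Mmx.
  by rewrite -scalemxAr scalerA -expr2 sqrr_sign scale1r.
have sa i (lt_ik : (i < k)%N) : (-1) ^+ i * a i = s * a i := Qmx_inj sQ lt_ik.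
have s1 : s = 1.
  by have := sa 0%N k_gt0; rewrite expr0 => /(mulIf a0) <-.
have N1 : (-1 : K) != 1 by rewrite eq_sym -subr_eq0 opprK.
have Deps : eps = ~~ odd k.
  move/eqP: s1; rewrite /s; clear -N1.
  by case: eps; case: (odd k); rewrite //= expr1 (negPf N1).
split=> //; exists a => //; split=> // i lt_ik odd_i.
have /eqP := sa i lt_ik; rewrite s1 -signr_odd odd_i expr1 mulN1r mul1r.
rewrite eq_sym -subr_eq0 opprK -mulr2n -mulr_natr mulf_eq0 (negPf nz2) orbF.
by move/eqP.
Qed.

(** Q / a_0 is unipotent and M-self-adjoint, so it has an M-self-adjoint square
    root P, and P^T M P = M P^2 = M Q / a_0. *)
Lemma jordan_gram_congr (a : nat -> K) : a 0%N != 0 ->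
  (forall i, (i < k)%N -> odd i -> a i = 0) ->
  exists P : 'M[K]_k, [/\ P \in unitmx, P *m Nmx k = Nmx k *m P
    & Mmx k *m Qmx k a = a 0%N *: (P^T *m Mmx k *m P)].
Proof.
move=> a0 a_odd.
pose W := (a 0%N)^-1 *: Qmx k a - 1%:M.
have MW : W^T *m Mmx k = Mmx k *m W.
  rewrite linearB /= linearZ /= trmx1 mulmxBl mulmxBr mul1mx mulmx1.
  by rewrite -scalemxAl -scalemxAr tr_even_Qmx_Mmx.
have WN : W *m Nmx k = Nmx k *m W.
  by rewrite mulmxBl mulmxBr mul1mx mulmx1 -scalemxAl -scalemxAr comm_Qmx_Nmx.
have [P [P2 MP PN]] : exists P, [/\ P *m P = 1%:M + W,
    P^T *m Mmx k = Mmx k *m P & P *m Nmx k = Nmx k *m P].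
  apply: unipotent_sqrt => // i j le_ji; rewrite !mxE QmxE.
  case: (ltngtP i j) le_ji => // [lt_ji | /val_inj->] _.
    by rewrite (introF eqP) ?mulr0 ?subr0 // => Eij; rewrite Eij ltnn in lt_ji.
  by rewrite subnn mulVf // eqxx subrr.
have DQ : Qmx k a = a 0%N *: (P *m P).
  by rewrite P2 addrC subrK scalerA divff // scale1r.
exists P; split=> //.
  by have := a0; rewrite -(Qmx_unit a k_gt0) DQ unitmxZ ?unitfE // unitmx_mul => /andP[].
by rewrite MP -mulmxA scalemxAr -DQ.
Qed.

(** P^T M P = M P(- N) P(N), and the upper left entry of P(- N) P(N) is the
    square of the constant term of P. *)
Lemma jordan_gram_scale (c : K) (P : 'M[K]_k) : P *m Nmx k = Nmx k *m P ->
  P^T *m Mmx k *m P = c *: Mmx k -> exists d, c = d ^+ 2.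
Proof.
move=> PN; rewrite (comm_NmxP k_gt0 PN); set a := fun n => _.
rewrite tr_Qmx_Mmx -mulmxA -[in RHS](mulmx1 (Mmx k)) scalemxAr.
move/(can_inj (mulKmx (Mmx_unit K k))).
pose o := Ordinal k_gt0; move/(congr1 (fun A : 'M_k => A o o)).
rewrite !mxE eqxx mulr1 (bigD1 o) //= big1 => [|l].
  by rewrite !QmxE /= subnn expr0 mul1r addr0 => <-; exists (a 0%N).
by rewrite -val_eqE /= -lt0n => l_gt0; rewrite !QmxE /= leqNgt l_gt0 mulr0.
Qed.

End GramMatrices.

(** * Gram matrices in a Jordan basis *)

Section GramMatrix.
Variables (K : fieldType) (U : vectType K).
Local Notation k := (\dim {:U}).
Variables (x : k.-tuple U) (x_basis : basis_of {:U} x).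
Local Notation rV := (passmx.rVof x).
Local Notation mxof := (passmx.mxof x x).
Implicit Types (kappa : {biscalar U}) (g h eta : 'End(U)).

Definition gram (f : U -> U -> K) : 'M[K]_k := \matrix_(i, j) f x`_i x`_j.

Lemma gramE kappa u v : kappa u v = (rV u *m gram kappa *m (rV v)^T) 0 0.
Proof.
rewrite {1}(coord_basis x_basis (memvf u)) {1}(coord_basis x_basis (memvf v)).
rewrite mxE linear_sumr; apply: eq_bigr => j _.
rewrite linear_sumlz !mxE mulr_suml; apply: eq_bigr => i _.
rewrite linearZl_LR linearZr_LR !mxE /=; ring.
Qed.

Lemma row_rVof (i : 'I_k) g : rV (g x`_i) = row i (mxof g).
Proof. by rewrite (passmx.rVof_app x x_basis) passmx.rVofE ?basis_free // -rowE. Qed.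

Lemma gram_comp kappa g h :
  gram (fun u v => kappa (g u) (h v)) = mxof g *m gram kappa *m (mxof h)^T.
Proof.
apply/matrixP => i j; rewrite mxE gramE !row_rVof -row_mul tr_row.
rewrite [LHS]mxE [RHS]mxE; apply: eq_bigr => l _.
by rewrite [row _ _ _ _]mxE [col _ _ _ _]mxE.
Qed.

Lemma gram_unit kappa : trivial_radical kappa <-> gram kappa \in unitmx.
Proof.
split=> [k0 | k_unit u ku].
  rewrite -row_free_unit; apply: inj_row_free => v vA0.
  have v0 : passmx.vecof x v = 0.
    apply: k0 => w; rewrite gramE passmx.vecofK ?basis_free //.
    by rewrite vA0 mul0mx mxE.
  by apply/eqP; rewrite -(passmx.vecof_eq0 x_basis) v0.
have uA0 : rV u *m gram kappa = 0.
  apply/rowP => j; have := ku x`_j.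
  rewrite gramE passmx.rVofE ?basis_free // trmx_delta -colE !mxE.
  by [].
apply/eqP; rewrite -(passmx.rVof_eq0 x_basis) -[rV u](mulmxK k_unit) uA0.
by rewrite mul0mx.
Qed.

Lemma tr_gram eps (kappa : {hermitian U for eps & idfun}) :
  (gram kappa)^T = (-1) ^+ eps *: gram kappa.
Proof. by apply/matrixP => i j; rewrite !mxE hermC. Qed.

Lemma hermitian_of_gram (eps : bool) (A : 'M[K]_k) : A^T = (-1) ^+ eps *: A ->
  exists kappa : {hermitian U for eps & idfun}, gram kappa = A.
Proof.
move=> trA; pose f u v := (rV u *m A *m (rV v)^T) 0 0.
have [||kappa Dk] := @hermitian_of K U eps f.
- by move=> w a u v; rewrite /f passmx.rVof_linear !mulmxDl -!scalemxAl !mxE.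
- move=> u v; rewrite /f.
  have -> : rV u *m A *m (rV v)^T = (rV v *m A^T *m (rV u)^T)^T.
    by rewrite !trmx_mul !trmxK mulmxA.
  by rewrite trA mxE -scalemxAr -scalemxAl mxE.
exists kappa; apply/matrixP => i j; rewrite mxE Dk /f !passmx.rVofE ?basis_free //.
by rewrite -rowE trmx_delta -colE !mxE.
Qed.

(** Coordinates are row vectors here, whence the transpose of N. *)
Lemma mxof_jordan eta lambda : jordan_basis eta lambda x ->
  mxof eta = lambda%:M + (Nmx k)^T.
Proof.
case=> _ eta0 etaS; have freex := basis_free x_basis.
apply/matrixP => i j.
have -> : mxof eta i j = coord x j (eta x`_i).
  by have := congr1 (fun v : 'rV_k => v 0 j) (row_rVof i eta); rewrite !mxE.
rewrite !mxE; case: (posnP i) => [i0 | i_gt0].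
  have -> : eta x`_i = lambda *: x`_i by rewrite i0.
  by rewrite linearZ /= coord_free // i0 addr0 mulr_natr.
have lt_i1 : (i.-1 < k)%N by have := ltn_ord i; lia.
have coord_pred : coord x j x`_i.-1 = (i.-1 == j)%:R.
  exact: (coord_free (Ordinal lt_i1) j freex).
rewrite etaS ?i_gt0 ?ltn_ord // linearD linearZ /= coord_free // coord_pred.
rewrite addrC mulr_natr; congr (_ + _).
by have -> : (i.-1 == j) = (i == j.+1 :> nat) by lia.
Qed.

Lemma complement_adjoint_gram kappa eta : complement_adjoint eta kappa <->
  mxof eta *m gram kappa + gram kappa *m (mxof eta)^T = gram kappa.
Proof.
have Dsum u v : kappa (eta u) v + kappa u (eta v) =
    (rV u *m (mxof eta *m gram kappa + gram kappa *m (mxof eta)^T) *m (rV v)^T) 0 0.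
  rewrite !gramE !(passmx.rVof_app x x_basis) trmx_mul mulmxDr mulmxDl !mulmxA.
  by rewrite [RHS]mxE.
split=> [kE | AE u v]; last by rewrite Dsum AE -gramE.
apply/matrixP => i j; have := kE x`_i x`_j.
rewrite Dsum gramE !(passmx.rVofE x_basis) trmx_delta -colE.
by rewrite -!rowE -!colE !mxE.
Qed.

(** The two halves coming from the eigenvalue of eta add up to the right-hand
    side of the adjointness condition and cancel. *)
Lemma complement_adjoint_half kappa eta : (2%:R : K) != 0 ->
  jordan_basis eta 2%:R^-1 x ->
  complement_adjoint eta kappa <->
    (Nmx k)^T *m gram kappa = - (gram kappa *m Nmx k).
Proof.
move=> nz2 /mxof_jordan eta_mx; rewrite complement_adjoint_gram eta_mx.
rewrite linearD /= trmxK tr_scalar_mx mulmxDl mulmxDr mul_scalar_mx mul_mx_scalar.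
set A := gram kappa; rewrite addrACA -scalerDl.
have -> : 2%:R^-1 + 2%:R^-1 = 1 :> K by field.
rewrite scale1r; split=> [/eqP | ->]; last by rewrite addNr addr0.
by rewrite -subr_eq0 addrAC subrr add0r addr_eq0 => /eqP.
Qed.

Lemma frameE (i : 'I_k) :
  [/\ tnth (frame x) (lshift (k + k) i) = in1 x`_i,
      tnth (frame x) (rshift k (lshift k i)) = in2 x`_i
    & tnth (frame x) (rshift k (rshift k i)) = in3 x`_i].
Proof.
have lt_i := ltn_ord i.
split; rewrite (tnth_nth 0) /= !nth_cat !size_map size_tuple.
- by rewrite lt_i (nth_map 0) ?size_tuple.
- by rewrite ltnNge leq_addr /= addKn lt_i (nth_map 0) ?size_tuple.
by rewrite ltnNge leq_addr /= addKn ltnNge leq_addr /= addKn (nth_map 0) ?size_tuple.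
Qed.

Lemma coordinate_mx_glue kappa : coordinate_mx (frame x) (glue kappa) = Hmx (gram kappa).
Proof.
apply/matrixP => i j; rewrite mxE /Hmx.
case: (split_ordP i) => {}i ->; last case: (split_ordP i) => {}i ->;
case: (split_ordP j) => {}j ->; try case: (split_ordP j) => {}j ->;
have [t1 t2 t3] := frameE i; have [t1' t2' t3'] := frameE j;
rewrite ?(t1, t2, t3) ?(t1', t2', t3') /glue /=;
rewrite ?(block_mxEul, block_mxEur, block_mxEdl, block_mxEdr);
rewrite ?(row_mxEl, row_mxEr, col_mxEu, col_mxEd);
rewrite ?(block_mxEul, block_mxEur, block_mxEdl, block_mxEdr);
by rewrite !mxE !(linear0l, linear0r) ?(sub0r, subr0, oppr0).
Qed.

End GramMatrix.

Section HalfEigenvalue.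
Variables (K : fieldType) (U : vectType K) (eta : 'End(U)).
Local Notation k := (\dim {:U}).
Variables (x : k.-tuple U).
Hypotheses (K_char : 2%N \notin [pchar K]) (x_jordan : jordan_basis eta 2%:R^-1 x).

Let nz2 : (2%:R : K) != 0. Proof. exact: two_neq0. Qed.

Let x_basis : basis_of {:U} x. Proof. by case: x_jordan. Qed.

Lemma jordan_gram_compatible (eps : bool) (kappa : {hermitian U for eps & idfun}) :
  trivial_radical kappa /\ complement_adjoint eta kappa <-> jordan_gram eps (gram x kappa).
Proof.
rewrite (gram_unit x_basis kappa) (complement_adjoint_half x_basis kappa nz2 x_jordan).
by split=> [[] | []] //; split=> //; apply: tr_gram.
Qed.

Lemma compatible_gram (eps : bool) (B : {hermitian (cube U) for eps & idfun}) :
  compatible_form (Seta eta) B ->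
  exists2 kappa : {hermitian U for eps & idfun},
    jordan_gram eps (gram x kappa) & forall u v, B u v = glue kappa u v.
Proof.
case/compatible_glue => kappa [k0 kE DB]; exists kappa => //.
exact/jordan_gram_compatible.
Qed.

Lemma gram_compatible (eps : bool) (A : 'M[K]_k) : jordan_gram eps A ->
  exists (kappa : {hermitian U for eps & idfun})
         (B : {hermitian (cube U) for eps & idfun}),
    [/\ gram x kappa = A, forall u v, B u v = glue kappa u v
      & compatible_form (Seta eta) B].
Proof.
move=> jA; have [_ trA _] := jA.
have [kappa DA] := hermitian_of_gram x_basis trA.
have [k0 kE] : trivial_radical kappa /\ complement_adjoint eta kappa.
  by apply/jordan_gram_compatible; rewrite DA.
by have [B BC DB] := glue_compatible k0 kE; exists kappa, B.
Qed.

Lemma coordinate_mxE (eps : bool) (kappa : {hermitian U for eps & idfun})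
    (B : cube U -> cube U -> K) : (forall u v, B u v = glue kappa u v) ->
  coordinate_mx (frame x) B = Hmx (gram x kappa).
Proof.
move=> DB; rewrite -(coordinate_mx_glue x kappa).
by apply/matrixP => i j; rewrite !mxE DB.
Qed.

Lemma mxof_comm (g : 'End(U)) : (forall u, g (eta u) = eta (g u)) <->
  (passmx.mxof x x g)^T *m Nmx k = Nmx k *m (passmx.mxof x x g)^T.
Proof.
set G := passmx.mxof x x g; set E := passmx.mxof x x eta.
have comm_GE : (forall u, g (eta u) = eta (g u)) <-> E *m G = G *m E.
  rewrite -!(passmx.mxof_comp x x x_basis); split=> [gE | ].
    by congr (passmx.mxof x x _); apply/lfunP => u; rewrite !comp_lfunE gE.
  move/(can_inj (passmx.mxofK x_basis x_basis)) => /lfunP gE u.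
  by have := gE u; rewrite !comp_lfunE.
rewrite comm_GE /E (mxof_jordan x_basis x_jordan) mulmxDl mulmxDr.
rewrite mul_scalar_mx mul_mx_scalar.
split=> [/addrI/(congr1 trmx) | /(congr1 trmx)]; rewrite !trmx_mul !trmxK => -> //.
Qed.

(** P is the matrix on column vectors of the g for which g x g x g is the
    isometry. *)
Lemma isometric_gram (kappa kappa' : {biscalar U}) (P : 'M[K]_k) :
    P \in unitmx -> P *m Nmx k = Nmx k *m P ->
    gram x kappa' = P^T *m gram x kappa *m P ->
  isometric_via_aut (Seta eta) (glue kappa') (glue kappa).
Proof.
move=> P_unit PN Dk'; pose g := passmx.hommx x x P^T.
have Dg : passmx.mxof x x g = P^T by rewrite (passmx.hommxK x_basis).
have gE u : g (eta u) = eta (g u) by move: u; apply/mxof_comm; rewrite Dg trmxK.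
have g_inj : injective g.
  apply: (can_inj (g := passmx.hommx x x (invmx P)^T)) => u.
  rewrite -(comp_lfunE (passmx.hommx x x (invmx P)^T) g) -[RHS](id_lfunE u).
  congr (fun_of_lfun _ u).
  apply: (can_inj (passmx.mxofK x_basis x_basis)).
  rewrite (passmx.mxof_comp x x x_basis) Dg (passmx.hommxK x_basis) //.
  by rewrite -trmx_mul mulVmx // trmx1 (passmx.mxof1 (basis_free x_basis)).
exists (linfun (cube_map g)); first exact: cube_map_iso.
have Dkk' u v : kappa' u v = kappa (g u) (g v).
  rewrite !(gramE x_basis) !(passmx.rVof_app x x_basis) Dg Dk' trmx_mul trmxK.
  by rewrite !mulmxA.
by move=> u v; rewrite !lfunE /glue /= !Dkk'.
Qed.

Lemma gram_isometric (kappa kappa' : {biscalar U}) :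
  isometric_via_aut (Seta eta) (glue kappa') (glue kappa) ->
  exists2 P : 'M[K]_k, P *m Nmx k = Nmx k *m P
    & gram x kappa' = P^T *m gram x kappa *m P.
Proof.
case=> f /Seta_automorphism[g gE Df] Dk; exists (passmx.mxof x x g)^T.
  exact/mxof_comm.
rewrite trmxK -(gram_comp x_basis); apply/matrixP => i j; rewrite !mxE.
have := Dk (in2 x`_i) (in2 x`_j).
by rewrite !Df /glue /= !linear0 !subr0.
Qed.

End HalfEigenvalue.

(** * The classification *)

Theorem theorem7p1 (K : fieldType) (K_perfect : perfect_field K)
    (K_char : 2%N \notin [pchar K])
    (k : nat) (k_ge1 : (1 <= k)%N)
    (U : vectType K) (dimU : \dim {:U} = k)
    (eta : 'End(U)) (eta_indec : indecomposable_end eta)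
    (lambda : K) (eta_lambda : passmx.leigenvalue eta lambda) :
  (isomorphic (Seta eta) (dual_sextuple (Seta eta)) <-> lambda = 2%:R^-1)
  /\
  forall b : (k + (k + k)).-tuple (cube U),
    jordan_frame_basis eta lambda b ->
    lambda = 2%:R^-1 ->
    exists B : {hermitian (cube U) for ~~ odd k & idfun},
      [/\
          compatible_form (Seta eta) B /\ coordinate_mx b B = Hmx (Mmx k),
          forall (eps : bool) (B' : {hermitian (cube U) for eps & idfun}),
            compatible_form (Seta eta) B' ->
            exists2 c : K, c != 0 &
              isometric_via_aut (Seta eta) B' (fun u v => c * B u v),
          (~~ odd k -> forall B' : {symmetric (cube U)},
              ~ compatible_form (Seta eta) B') /\
          (odd k -> forall B' : {skew_symmetric (cube U)},
              ~ compatible_form (Seta eta) B'),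
          forall c : K, c != 0 ->
            (isometric_via_aut (Seta eta) (fun u v => c * B u v) B
             <-> exists d : K, c = d ^+ 2)
        &
          forall H : 'M[K]_(k + (k + k)),
            (exists2 B' : {hermitian (cube U) for ~~ odd k & idfun},
               compatible_form (Seta eta) B' & coordinate_mx b B' = H)
            <->
            (exists2 a : nat -> K,
               a 0%N != 0 /\ (forall i, (i < k)%N -> odd i -> a i = 0)
               & H = Hmx (Mmx k *m Qmx k a))].
Proof.
subst k; split.
  split=> [[f /dual_iso_glue[kappa]] | half].
    exact: complement_adjoint_eigenvalue.
  have [x x_jordan] := indecomposable_jordan_basis erefl eta_indec eta_lambda.
  rewrite half in x_jordan.
  have [kappa [B [Dk _ _]]] :=
    gram_compatible K_char x_jordan (Mmx_jordan_gram K (\dim {:U})).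
  have [k0 kE] : trivial_radical kappa /\ complement_adjoint eta kappa.
    apply/(jordan_gram_compatible K_char x_jordan); rewrite Dk.
    exact: Mmx_jordan_gram.
  exact: glue_dual_iso k0 kE.
move=> b [x [_ _ ->] x_jordan] half; rewrite half in x_jordan.
have [kappa [B [Dk DB BC]]] :=
  gram_compatible K_char x_jordan (Mmx_jordan_gram K (\dim {:U})).
have scaled (c : K) : exists2 ck : {biscalar U},
    gram x ck = c *: Mmx _ & forall u v, c * B u v = glue ck u v.
  have [|ck Dck] := @biscalar_of K U (fun u v => c * kappa u v).
    split=> w a u v /=.
      rewrite linearDl linearZl_LR /=; ring.
    rewrite linearDr linearZr_LR /=; ring.
  exists ck => [|u v].
    by rewrite -Dk; apply/matrixP => i j; rewrite !mxE Dck.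
  rewrite DB /glue !Dck; ring.
(* The symmetry type of a compatible form is determined by the parity of the
   dimension. *)
have parity (eps : bool) (B' : {hermitian (cube U) for eps & idfun}) :
    compatible_form (Seta eta) B' -> eps = ~~ odd (\dim {:U}).
  move=> /(compatible_gram K_char x_jordan)[kappa' /(jordan_gramP K_char k_ge1)[]].
  by [].
exists B; split.
- by split=> //; rewrite (coordinate_mxE x DB) Dk.
- move=> eps B' /(compatible_gram K_char x_jordan)[kappa'].
  move/(jordan_gramP K_char k_ge1) => [_ [a [a0 a_odd] Dk'] DB'].
  have [P [P_unit PN DMQ]] := jordan_gram_congr K_char k_ge1 a0 a_odd.
  have [ck Dck DcB] := scaled (a 0%N); exists (a 0%N) => //.
  have [|f f_iso Df] := @isometric_gram _ _ eta x x_jordan ck kappa' P P_unit PN.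
    by rewrite Dk' DMQ Dck -scalemxAr -scalemxAl.
  by exists f => // u v; rewrite DB' DcB Df.
- split=> [even_k | odd_k] B' /parity; first by rewrite even_k.
  by rewrite odd_k.
- move=> c nz_c; have [ck Dck DcB] := scaled c.
  split=> [[f f_iso Df] | [d Dc]].
    have [|P PN] := @gram_isometric _ _ eta x x_jordan kappa ck.
      by exists f => // u v; rewrite -DcB Df DB.
    by rewrite Dk Dck => /esym/(jordan_gram_scale k_ge1 PN).
  have nz_d : d != 0 by apply: contraNneq nz_c => d0; rewrite Dc d0 expr0n.
  (* Multiplication by d is an automorphism that scales the form by d^2. *)
  have [|||f f_iso Df] := @isometric_gram _ _ eta x x_jordan kappa ck d%:M.
  + by rewrite unitmxE det_scalar unitfE expf_neq0.
  + by rewrite mul_scalar_mx mul_mx_scalar.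
  + by rewrite Dk Dck tr_scalar_mx mul_scalar_mx mul_mx_scalar scalerA Dc.
  by exists f => // u v; rewrite DcB Df DB.
move=> H; split=> [[B' /(compatible_gram K_char x_jordan)[kappa' jk DB'] <-] | [a [a0 a_odd] ->]].
  have [_ [a aP Dk']] := jordan_gramP K_char k_ge1 jk.
  by exists a => //; rewrite (coordinate_mxE x DB') Dk'.
have [kappa' [B' [Dk' DB' BC']]] :=
  gram_compatible K_char x_jordan (MQ_jordan_gram k_ge1 a0 a_odd).
by exists B' => //; rewrite (coordinate_mxE x DB') Dk'.
Qed.
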